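(* Let $M$ be an 8-manifold with a Cayley form $\Phi$, let $g$ be the Riemannian metric determined by $\Phi$, and let $\nabla$ be the Levi-Civita connection of $g$. Then the tensor $\nabla_i\Phi_{abcd}$ (which measures the intrinsic torsion of the $\mathrm{Spin}(7)$-structure) takes values in $\Lambda^1\otimes\Lambda^4_7$. Moreover, the intrinsic torsion can be parametrised by a 3-form: there is $T\in\Lambda^3$ such that $$\nabla_i\Phi_{abcd}=4\,T_{i[a}{}^{p}\,\Phi_{|p|bcd]} .$$
   Context: A Cayley form ($\mathrm{Spin}(7)$-structure) on an 8-manifold $M$ is a 4-form $\Phi$ which at each point lies in a fixed $\mathrm{GL}(8,\mathbb{R})$-orbit of 4-forms with stabiliser $\mathrm{Spin}(7)$. It determines a Riemannian metric $g$ and an orientation. The conventions are fixed by the identity (all contractions and index raisings with $g$) $$\Phi_{ijkp}\Phi_{abc}{}^{p}= g_{ia}g_{jb}g_{kc}+g_{ib}g_{jc}g_{ka}+g_{ic}g_{ja}g_{kb}-g_{ia}g_{jc}g_{kb}-g_{ic}g_{jb}g_{ka}-g_{ib}g_{ja}g_{kc}$$ $$-g_{ia}\Phi_{jkbc}-g_{ja}\Phi_{kibc}-g_{ka}\Phi_{ijbc}-g_{ib}\Phi_{jkca}-g_{jb}\Phi_{kica}-g_{kb}\Phi_{ijca}-g_{ic}\Phi_{jkab}-g_{jc}\Phi_{kiab}-g_{kc}\Phi_{ijab},$$ and $\Phi$ is self-dual: $\frac1{4!}\epsilon_{ijkl}{}^{abcd}\Phi_{abcd}=\Phi_{ijkl}$,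 with $\epsilon$ the volume form of $g$. Square brackets denote antisymmetrisation with weight one ($\frac{1}{k!}\sum_p(-1)^p$); indices between vertical bars are excluded from it. $\Lambda^k$ denotes (sections of) the bundle of $k$-forms. The space $\Lambda^4_7\subset\Lambda^4$ is the eigenspace with eigenvalue $-6$ of the operator $J_4:\Lambda^4\to\Lambda^4$, $J_4(\sigma)_{ijkl}=3\,\Phi_{[ij}{}^{pq}\sigma_{kl]pq}$. *)

(* Defs.v *)
From mathcomp Require Import all_boot all_order all_algebra all_fingroup.
From mathcomp Require Import all_classical all_reals all_analysis.
Set Implicit Arguments.
Unset Strict Implicit.
Unset Printing Implicit Defensive.
Import Order.TTheory GRing.Theory Num.Theory.
Import numFieldNormedType.Exports.
Local Open Scope classical_set_scope.
Local Open Scope ring_scope.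

Section Smooth.
Variables (R : realType) (n : nat).

Definition partial (i : 'I_n) (f : 'rV[R]_n -> R) : 'rV[R]_n -> R :=
  fun x => 'D_(delta_mx 0 i) f x.

(* For open U: a map is C^(k+1) iff it is differentiable with C^k partial
   derivatives. *)
Fixpoint Ck (k : nat) (U : set 'rV[R]_n) (f : 'rV[R]_n -> R) : Prop :=
  match k with
  | 0 => forall x, U x -> {for x, continuous f}
  | k'.+1 => (forall x, U x -> differentiable f x) /\
             (forall i, Ck k' U (partial i f))
  end.

Definition smooth_on (U : set 'rV[R]_n) (f : 'rV[R]_n -> R) : Prop :=
  forall k, Ck k U f.

End Smooth.

Record chart (R : realType) (n : nat) (M : topologicalType) := Chart {
  dom : set M;
  coord : M -> 'rV[R]_n;
  param : 'rV[R]_n -> M;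
  dom_open : open dom;
  codom_open : open (coord @` dom);
  coordK : forall p, dom p -> param (coord p) = p;
  coord_continuous : forall p, dom p -> {for p, continuous coord};
  param_continuous :
    forall x, (coord @` dom) x -> {for x, continuous param}
}.

Record manifold (R : realType) (n : nat) := Manifold {
  space :> topologicalType;
  space_hausdorff : hausdorff_space space;
  space_second_countable : @second_countable space;
  chart_index : Type;
  atlas : chart_index -> chart R n space;
  atlas_cover : forall p : space, exists c, dom (atlas c) p;
  atlas_smooth : forall (c d : chart_index) (k : 'I_n),
    smooth_on (coord (atlas c) @` (dom (atlas c) `&` dom (atlas d)))
      (fun x => coord (atlas d) (param (atlas c) x) 0 k)
}.

Arguments atlas {R n} _ _.
Arguments chart_index {R n} _.

Section Tensors.
Variables (R : realType) (n : nat).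

Definition tensor (k : nat) := k.-tuple 'I_n -> R.

(* (A^* T)_(t_1 .. t_k) = A^(u_1)_(t_1) .. A^(u_k)_(t_k) T_(u_1 .. u_k) *)
Definition pullback k (A : 'M[R]_n) (T : tensor k) : tensor k :=
  fun t => \sum_(u : k.-tuple 'I_n) (\prod_(s < k) A (tnth u s) (tnth t s)) * T u.

Definition permute k (s : 'S_k) (t : k.-tuple 'I_n) : k.-tuple 'I_n :=
  [tuple tnth t (s r) | r < k].

Definition alternating k (T : tensor k) : Prop :=
  forall (s : 'S_k) t, T (permute s t) = (-1) ^+ s * T t.

Definition alt k (T : tensor k) : tensor k :=
  fun t => (k`!%:R)^-1 * \sum_(s : 'S_k) (-1) ^+ s * T (permute s t).

Definition replace k (t : k.-tuple 'I_n) (s : 'I_k) (p : 'I_n) :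
    k.-tuple 'I_n :=
  [tuple if r == s then p else tnth t r | r < k].

Definition kronecker : tensor 2 := fun t => (tnth t 0 == tnth t 1)%:R.

Definition mx_of_tensor (g : tensor 2) : 'M[R]_n :=
  \matrix_(i, j) g [tuple i; j].

End Tensors.

Section Fields.
Variables (R : realType) (n : nat) (M : manifold R n).

Local Notation index := (chart_index M).
Local Notation U c := (dom (atlas M c)).
Local Notation x_ c := (coord (atlas M c)).
Local Notation x_inv c := (param (atlas M c)).

(* Fields are given by their components in each chart; the values of
   [F c] outside of the domain of [c] are irrelevant. *)
Definition partial_at (c : index) (i : 'I_n) (f : M -> R) (p : M) : R :=
  partial i (fun x => f (x_inv c x)) (x_ c p).

Definition smooth_in (c : index) (f : M -> R) : Prop :=
  smooth_on (x_ c @` U c) (fun x => f (x_inv c x)).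

(* entry (r, i): derivative of the r-th coordinate of c along the i-th
   coordinate of d *)
Definition jacobian (c d : index) (p : M) : 'M[R]_n :=
  \matrix_(r, i) partial_at d i (fun q => x_ c q 0 r) p.

Definition hessian (c d : index) (p : M) (r i j : 'I_n) : R :=
  partial_at d i (fun q => jacobian c d q r j) p.

Record tensor_field (k : nat) := TensorField {
  component :> index -> M -> tensor R n k;
  component_smooth : forall c t, smooth_in c (fun p => component c p t);
  component_change : forall c d p, U c p -> U d p ->
    component d p =1 pullback (jacobian c d p) (component c p)
}.

Definition is_form k (w : tensor_field k) : Prop :=
  forall c p, U c p -> alternating (w c p).

Definition riemannian_metric (g : tensor_field 2) : Prop :=
  forall c p, U c p ->
    (forall i j, g c p [tuple i; j] = g c p [tuple j; i]) /\
    (forall v : 'rV[R]_n, v != 0 ->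
       0 < \sum_i \sum_j g c p [tuple i; j] * v 0 i * v 0 j).

(* Affine connections on TM: [christoffel c p k i j] is the k-th component of
   nabla_(d_i) d_j in the chart c. *)
Record connection := Connection {
  christoffel :> index -> M -> 'I_n -> 'I_n -> 'I_n -> R;
  christoffel_smooth :
    forall c k i j, smooth_in c (fun p => christoffel c p k i j);
  christoffel_change : forall c d p k i j, U c p -> U d p ->
    christoffel d p k i j =
    \sum_r jacobian d c p k r *
      (\sum_s \sum_t christoffel c p r s t *
                       jacobian c d p s i * jacobian c d p t j
       + hessian c d p r i j)
}.

Definition nabla (D : connection) k (T : tensor_field k)
    (c : index) (p : M) (i : 'I_n) : tensor R n k :=
  fun t => partial_at c i (fun q => T c q t) p
           - \sum_(s < k) \sum_q D c p q i (tnth t s) * T c p (replace t s q).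

Definition torsion_free (D : connection) : Prop :=
  forall c p k i j, U c p -> D c p k i j = D c p k j i.

Definition levi_civita (g : tensor_field 2) (D : connection) : Prop :=
  torsion_free D /\
  (forall c p i t, U c p -> nabla D g c p i t = 0).

End Fields.

Section CayleyForms.
Variable R : realType.

(* the value of the constant form dx^(q_0) /\ .. /\ dx^(q_3) on the coordinate
   vectors indexed by t *)
Definition dx4 (q : seq nat) : tensor R 8 4 :=
  fun t => \det (\matrix_(r < 4, s < 4) (nth 0%N q r == tnth t s)%:R).

(* The form of Joyce and Bryant up to an overall sign, which selects between
   two distinct GL(8)-orbits.  With the sign chosen here, the flat metric and
   the orientation dx^0 /\ .. /\ dx^7, the form is self-dual and satisfies
     Phi_ijkp Phi_abcp = g_ia g_jb g_kc + .. - g_ia Phi_jkbc - ..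
   (the opposite form is also self-dual, but satisfies this identity with
   + g_ia Phi_jkbc + ..). *)
Definition cayley0 : tensor R 8 4 := fun t =>
    \sum_(q <- [:: [:: 0; 3; 4; 7]; [:: 0; 3; 5; 6]; [:: 0; 2; 5; 7];
                   [:: 1; 2; 4; 7]; [:: 1; 2; 5; 6]; [:: 1; 3; 4; 6]]%N)
      dx4 q t
  - \sum_(q <- [:: [:: 0; 1; 2; 3]; [:: 0; 1; 4; 5]; [:: 0; 1; 6; 7];
                   [:: 0; 2; 4; 6]; [:: 1; 3; 5; 7]; [:: 2; 3; 4; 5];
                   [:: 2; 3; 6; 7]; [:: 4; 5; 6; 7]]%N)
      dx4 q t.

Definition J4 (g : tensor R 8 2) (Phi : tensor R 8 4) (w : tensor R 8 4) :
    tensor R 8 4 :=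
  let h := invmx (mx_of_tensor g) in
  fun t => 3 * alt (fun u : 4.-tuple 'I_8 =>
    let i := tnth u 0 in let j := tnth u 1 in
    let k := tnth u 2 in let l := tnth u 3 in
    \sum_p \sum_q \sum_r \sum_s
      Phi [tuple i; j; r; s] * h r p * h s q * w [tuple k; l; p; q]) t.

Definition Lambda4_7 (g : tensor R 8 2) (Phi : tensor R 8 4)
    (w : tensor R 8 4) : Prop :=
  alternating w /\ forall t, J4 g Phi w t = - 6 * w t.

(* t |-> T_(i[a}^p Phi_(|p|bcd]) at t = (a, b, c, d) *)
Definition torsion_action (g : tensor R 8 2) (Phi : tensor R 8 4)
    (T : tensor R 8 3) (i : 'I_8) : tensor R 8 4 :=
  let h := invmx (mx_of_tensor g) in
  alt (fun u : 4.-tuple 'I_8 =>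
    let a := tnth u 0 in let b := tnth u 1 in
    let c := tnth u 2 in let d := tnth u 3 in
    \sum_p \sum_q T [tuple i; a; q] * h q p * Phi [tuple p; b; c; d]).

Variable M : manifold R 8.

Definition cayley_form (Phi : tensor_field M 4) : Prop :=
  is_form Phi /\
  forall c p, dom (atlas M c) p ->
    exists2 A : 'M[R]_8, A \in unitmx & Phi c p =1 pullback A cayley0.

(* Well-posed because the stabiliser of cayley0 is contained in O(8). *)
Definition cayley_metric (Phi : tensor_field M 4) (g : tensor_field M 2) :
    Prop :=
  riemannian_metric g /\
  forall c p, dom (atlas M c) p ->
    exists A : 'M[R]_8, [/\ A \in unitmx, Phi c p =1 pullback A cayley0
                          & g c p =1 pullback A (@kronecker R 8)].

End CayleyForms.

(* Main.v *)
(* Contracting the identity for [Phi_ijkp Phi_abc^p] once more gives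
     Phi_ijpq Phi_kl^pq = 6 g_ik g_jl - 6 g_il g_jk - 4 Phi_ijkl.
   Its covariant derivative, with [nabla g = 0] and [X = nabla_m Phi], reads
     Phi_ij^pq X_klpq + Phi_kl^pq X_ijpq = -4 X_ijkl,
   and antisymmetrising this in [ijkl] yields [J_4 X = -6 X].

   As [Lambda^3] and [Lambda^1 (x) Lambda^4_7] have the same dimension 56 and
   are both the sum of irreducibles of dimensions 8 and 48, the 3-form can be
   recovered equivariantly from the divergence [D_abc = nabla^p Phi_pabc]:
     T_abc = - 5/12 D_abc - 1/8 D_[a^pq Phi_bc]pq.
   That this [T] works is a linear identity in an orthonormal frame, which is
   checked on the integer components of the flat Cayley form.  The formula is
   natural and rational in [Phi], [g] and [nabla Phi], so that [T] is a smooth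
   tensor field. *)
From Stdlib Require Import ZArith.
From mathcomp Require Import all_boot all_order all_algebra all_fingroup.
From mathcomp Require Import all_classical all_reals all_analysis.
From mathcomp Require Import ssrZ zify ring lra.
Require Import Defs.
Set Implicit Arguments.
Unset Strict Implicit.
Unset Printing Implicit Defensive.
Import Order.TTheory GRing.Theory Num.Theory.
Import numFieldNormedType.Exports.
Local Open Scope classical_set_scope.
Local Open Scope ring_scope.
Delimit Scope Z_scope with ZZ.

(** * Computations with the flat Cayley form *)

(** Origin of the constants in [T]: let [A T] denote [T_[a^pq Phi_bc]pq]. If [nabla Phi] is the
    action of [T], contraction gives [D = - 3 A T]. On the 3-forms [v^d Phi_dabc] the contracted
    quadratic identity gives [A = - 4]; as [A] is traceless on [Lambda^3], it is [2/3] on the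
    48-dimensional summand. Hence [3 A^2 + 10 A = 8], and replacing [A T] by [- D / 3] in
    [T = (10 A T + 3 A (A T)) / 8] yields the formula. The formula holds only on
    [Lambda^1 (x) Lambda^4_7], so the flat check has to use the eigenvalue equation. It serves to
    express the 70 components of each [X_i] through 7 unknowns; what remains is an identity between
    integer linear forms in 56 unknowns, decided by evaluation. The orbit condition provides an
    adapted frame at each point separately, with no continuity from point to point, so these frames
    cannot be differentiated. Only the quadratic identity, from which the frame has disappeared, is
    differentiated. *)

Definition when (b : bool) (z : Z) : Z := if b then z else 0%ZZ.

Definition det2 (x y c d : nat) : Z :=
  (when (eqn x c) (when (eqn y d) 1) - when (eqn y c) (when (eqn x d) 1))%ZZ.

Definition det3 (x y z b c d : nat) : Z :=
  (when (eqn x b) (det2 y z c d) - when (eqn y b) (det2 x z c d)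
   + when (eqn z b) (det2 x y c d))%ZZ.

Definition det4 (x y z w a b c d : nat) : Z :=
  (when (eqn x a) (det3 y z w b c d) - when (eqn y a) (det3 x z w b c d)
   + when (eqn z a) (det3 x y w b c d) - when (eqn w a) (det3 x y z b c d))%ZZ.

Definition cayleyZ (a b c d : nat) : Z :=
  (det4 0 3 4 7 a b c d + (det4 0 3 5 6 a b c d + (det4 0 2 5 7 a b c d
   + (det4 1 2 4 7 a b c d + (det4 1 2 5 6 a b c d + det4 1 3 4 6 a b c d))))
   - (det4 0 1 2 3 a b c d + (det4 0 1 4 5 a b c d + (det4 0 1 6 7 a b c d
      + (det4 0 2 4 6 a b c d + (det4 1 3 5 7 a b c d + (det4 2 3 4 5 a b c d
      + (det4 2 3 6 7 a b c d + det4 4 5 6 7 a b c d))))))))%ZZ.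

(** Addition in [F_2^3] of indices read in binary, tabulated so that the checks evaluate it by
    lookup. *)
Definition xor (i j : nat) : nat :=
  nth 0%N (nth [::]
    [:: [:: 0; 1; 2; 3; 4; 5; 6; 7]; [:: 1; 0; 3; 2; 5; 4; 7; 6];
        [:: 2; 3; 0; 1; 6; 7; 4; 5]; [:: 3; 2; 1; 0; 7; 6; 5; 4];
        [:: 4; 5; 6; 7; 0; 1; 2; 3]; [:: 5; 4; 7; 6; 1; 0; 3; 2];
        [:: 6; 7; 4; 5; 2; 3; 0; 1]; [:: 7; 6; 5; 4; 3; 2; 1; 0]]%N i) j.

(* The 14 quadruples of [cayley0] are the affine planes of [F_2^3], so three of
   the indices of a nonzero component determine the fourth. *)
Definition fourth (i j k : nat) : nat := xor (xor i j) k.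

Definition I8 : seq nat := [:: 0; 1; 2; 3; 4; 5; 6; 7]%N.

Definition sign_table : seq (seq (seq Z)) :=
  [seq [seq [seq cayleyZ i j k (fourth i j k) | k <- I8] | j <- I8] | i <- I8].

Definition sign (i j k : nat) : Z :=
  nth 0%ZZ (nth [::] (nth [::] sign_table i) j) k.

(** This form makes the support explicit: a contraction with [phi] over its last index has a single
    term, which saves one summation in all checks below. *)
Definition phi (i j k l : nat) : Z := when (eqn l (fourth i j k)) (sign i j k).

Definition all8 (P : nat -> bool) : bool := all P I8.

Lemma all8P (P : nat -> bool) : all8 P -> forall i, (i < 8)%N -> P i.
Proof.
by move=> /allP P8 i i8; apply: P8; rewrite -[I8]/(iota 0 8) mem_iota.
Qed.

Lemma cayleyZ_phi_check :
  all8 (fun i => all8 (fun j => all8 (fun k => all8 (fun l =>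
    Z.eqb (cayleyZ i j k l) (phi i j k l))))).
Proof. by vm_compute. Qed.

Lemma cayleyZ_phi i j k l : (i < 8)%N -> (j < 8)%N -> (k < 8)%N -> (l < 8)%N ->
  cayleyZ i j k l = phi i j k l.
Proof.
move=> i8 j8 k8 l8; apply/Z.eqb_eq.
by have /all8P/(_ _ i8)/all8P/(_ _ j8)/all8P/(_ _ k8)/all8P/(_ _ l8) :=
  cayleyZ_phi_check.
Qed.

Lemma fourth_lt_check :
  all8 (fun i => all8 (fun j => all8 (fun k => (fourth i j k < 8)%N))).
Proof. by vm_compute. Qed.

Lemma fourth_lt i j k : (i < 8)%N -> (j < 8)%N -> (k < 8)%N ->
  (fourth i j k < 8)%N.
Proof.
move=> i8 j8 k8.
by have /all8P/(_ _ i8)/all8P/(_ _ j8)/all8P/(_ _ k8) := fourth_lt_check.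
Qed.

Definition sum8 (f : nat -> Z) : Z := foldr (fun i s => (f i + s)%ZZ) 0%ZZ I8.

(** In the double contraction over [p] and [q], the first factor forces [q] to be [fourth i j p], so
    that only the sum over [p] remains. *)
Lemma phi_phi_check :
  all8 (fun i => all8 (fun j => all8 (fun a => all8 (fun b =>
    Z.eqb (sum8 (fun p => sign i j p * phi a b p (fourth i j p)))%ZZ
          (6 * (when (eqn i a) (when (eqn j b) 1)
                - when (eqn i b) (when (eqn j a) 1)) - 4 * phi i j a b))))).
Proof. by vm_compute. Qed.

Section FlatCayley.
Variable R : realType.

Definition zr (z : Z) : R := (int_of_Z z)%:~R.

Lemma zrD z w : zr (z + w)%ZZ = zr z + zr w.
Proof. by rewrite /zr -[(z + w)%ZZ]/(z + w) rmorphD rmorphD. Qed.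

Lemma zrM z w : zr (z * w)%ZZ = zr z * zr w.
Proof. by rewrite /zr -[(z * w)%ZZ]/(z * w) rmorphM rmorphM. Qed.

Lemma zrN z : zr (- z)%ZZ = - zr z.
Proof. by rewrite /zr -[(- z)%ZZ]/(- z) rmorphN rmorphN. Qed.

Lemma zrB z w : zr (z - w)%ZZ = zr z - zr w.
Proof. by rewrite -Z.add_opp_r zrD zrN. Qed.

Lemma zr_when b z : zr (when b z) = b%:R * zr z.
Proof. by case: b; rewrite /= ?mul1r ?mul0r. Qed.

Lemma zr_nat (n : nat) : zr (Z.of_nat n) = n%:R.
Proof. by rewrite /zr (_ : int_of_Z _ = n%:Z) //; lia. Qed.

Lemma zr0 : zr 0 = 0. Proof. by []. Qed.
Lemma zr1 : zr 1 = 1. Proof. by []. Qed.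

(** Expansion along the first column with entries given by a function on naturals: for a fixed size
    it unfolds by computation to a polynomial in the entries, which [\det] does not. *)
Fixpoint laplace n (f : nat -> nat -> R) : R :=
  if n is n'.+1 then
    \sum_(i < n'.+1) f i 0%N *
      ((-1) ^+ i * laplace n' (fun r s => f (bump i r) s.+1))
  else 1.

Lemma det_laplace n (f : nat -> nat -> R) :
  \det (\matrix_(r < n, s < n) f r s) = laplace n f.
Proof.
elim: n f => [|n IHn] f; first by rewrite det_mx00.
rewrite (expand_det_col _ ord0) /=; apply: eq_bigr => i _; rewrite mxE -IHn.
rewrite /cofactor addn0; congr (_ * (_ * \det _)).
by apply/matrixP => r s; rewrite !mxE.
Qed.

Lemma cayley0E (a b c d : 'I_8) :
  cayley0 R [tuple a; b; c; d] = zr (phi a b c d).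
Proof.
have det4E (x y z w : nat) :
    dx4 R [:: x; y; z; w] [tuple a; b; c; d] = zr (det4 x y z w a b c d).
  pose f r s : R := (nth 0%N [:: x; y; z; w] r ==
    nth 0%N [:: val a; val b; val c; val d] s)%:R.
  rewrite /dx4 (_ : \matrix_(_, _) _ = \matrix_(r < 4, s < 4) f r s); last first.
    apply/matrixP => r s; rewrite !mxE /f; congr (_ == _)%:R.
    by case: s => -[|[|[|[|]]]].
  rewrite det_laplace /= !big_ord_recl !big_ord0 /= /f /=.
  rewrite /det4 /det3 /det2 !eqnE !(zrB, zrD, zr_when, zr1).
  ring.
rewrite -cayleyZ_phi // /cayley0 !big_cons !big_nil !det4E.
by rewrite !addr0 /cayleyZ !(zrB, zrD).
Qed.

Lemma sum_I8 (F : nat -> R) : \sum_(p <- I8) F p = \sum_(p < 8) F p.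
Proof. by rewrite -[I8]/(index_iota 0 8) big_mkord. Qed.

Lemma sum_cayley0 (i j k : 'I_8) (F : 'I_8 -> R) :
  \sum_l cayley0 R [tuple i; j; k; l] * F l =
  zr (sign i j k) * F (inord (fourth i j k)).
Proof.
have lt8 := fourth_lt (ltn_ord i) (ltn_ord j) (ltn_ord k).
rewrite (bigD1 (inord (fourth i j k))) //= cayley0E /phi inordK // eqnE eqxx.
rewrite big1 ?addr0 // => l neq_l; rewrite cayley0E /phi eqnE.
by rewrite -{1}(inordK lt8) (inj_eq val_inj) (negbTE neq_l) /= zr0 mul0r.
Qed.

Lemma zr_sum8 (f : nat -> Z) : zr (sum8 f) = \sum_(p < 8) zr (f p).
Proof.
rewrite -(sum_I8 (zr \o f)) /sum8; elim: I8 => [|p s IHs] /=.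
  by rewrite big_nil.
by rewrite big_cons zrD IHs.
Qed.

Lemma cayley0_cayley0 (i j a b : 'I_8) :
  \sum_p \sum_q cayley0 R [tuple i; j; p; q] * cayley0 R [tuple a; b; p; q] =
  6 * ((i == a)%:R * (j == b)%:R - (i == b)%:R * (j == a)%:R)
  - 4 * cayley0 R [tuple i; j; a; b].
Proof.
have /all8P/(_ _ (ltn_ord i))/all8P/(_ _ (ltn_ord j)) := phi_phi_check.
move=> /all8P/(_ _ (ltn_ord a))/all8P/(_ _ (ltn_ord b))/Z.eqb_eq/(congr1 zr).
rewrite zr_sum8 !(zrB, zrM) !zr_when !eqnE !mulr1.
rewrite -[6%ZZ]/(Z.of_nat 6) -[4%ZZ]/(Z.of_nat 4) !zr_nat.
rewrite cayley0E /phi zr_when eqnE => <-.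
apply: eq_bigr => p _; rewrite sum_cayley0 cayley0E inordK ?zrM //.
exact: fourth_lt.
Qed.

End FlatCayley.

(** * Reflection of linear relations *)

(** Sparse linear forms: an unknown is named by a list of indices and paired with its coefficient.
    [insert] keeps the keys sorted so that like terms merge; soundness of evaluation rests only on
    merged keys being equal, not on the order. *)
Definition form : Type := seq (seq nat * Z).

Fixpoint compare_key (k l : seq nat) : comparison :=
  match k, l with
  | a :: k', b :: l' =>
      if eqn a b then compare_key k' l' else if (a < b)%N then Lt else Gt
  | [::], [::] => Eq
  | [::], _ => Lt
  | _, _ => Gt
  end.

Fixpoint insert (z : Z) (k : seq nat) (f : form) : form :=
  match f with
  | [::] => [:: (k, z)]
  | m :: f' => match compare_key k m.1 with
               | Lt => (k, z) :: f
               | Eq => (k, z + m.2)%ZZ :: f'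
               | Gt => m :: insert z k f'
               end
  end.

Definition add_form (z : Z) (g f : form) : form :=
  foldr (fun m f => insert (z * m.2) m.1 f) f g.

Definition null_form (f : form) : bool := all (fun m => Z.eqb m.2 0) f.

(** A comparator of a sorting network, in continuation-passing style: an exchange costs a sign, and
    two equal indices mean a vanishing component, so that [f] is returned as it is. Six of them in
    bubble-sort order put four indices in increasing order. *)
Definition swap_term (z : Z) (x y : nat) (f : form)
    (k : Z -> nat -> nat -> form) : form :=
  if (x < y)%N then k z x y else if eqn x y then f else k (- z)%ZZ y x.

(* adds [z] times the component [a b c d] of an alternating tensor to [f] *)
Definition add_term (z : Z) (a b c d : nat) (f : form) : form :=
  if Z.eqb z 0 then f else
  swap_term z a b f (fun z a b => swap_term z b c f (fun z b c =>
  swap_term z c d f (fun z c d => swap_term z a b f (fun z a b =>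
  swap_term z b c f (fun z b c => swap_term z a b f (fun z a b =>
    insert z [:: a; b; c; d] f)))))).

(** The contraction [Phi_ab^pq X_cdpq], with [q] already determined by [p]. *)
Definition add_half (z : Z) (a b c d : nat) (f : form) : form :=
  foldr (fun p f => add_term (z * sign a b p) c d p (fourth a b p) f) f I8.

Definition add_contraction (z : Z) (a b c d : nat) (f : form) : form :=
  add_half z a b c d (add_half z c d a b f).

(** By the antisymmetry in each pair, the 24 terms of the alternation in [J4] reduce to the six
    ordered splittings of [abcd] into two pairs, and the factors 3 and 1/6 leave 1/2; hence [2 J4].
    Keys that name no component are multiplied by the eigenvalue -12, so that [eval_add_row] holds
    for every key. *)
Definition add_row (z : Z) (k : seq nat) (f : form) : form :=
  match k with
  | [:: a; b; c; d] =>
      if [&& a < 8, b < 8, c < 8 & d < 8]%N then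
        add_contraction z a b c d
          (add_contraction (- z) a c b d (add_contraction z a d b c f))
      else insert (-12 * z) k f
  | _ => insert (-12 * z) k f
  end.

(* twice the operator [J4], acting on linear forms *)
Definition add_J4 (g f : form) : form :=
  foldr (fun m f => add_row m.2 m.1 f) f g.

(* The eigenvalues of [2 J4] are -24, -12, 4, 0, so that [L (L - 4) (L + 24)]
   with [L = 2 J4] is a multiple of the projection onto the 7-dimensional
   eigenspace; on this eigenspace it is the multiplication by 2304. *)
Definition project (f : form) : form :=
  let f1 := add_J4 f (add_form 24 f [::]) in
  let f2 := add_J4 f1 (add_form (-4) f1 [::]) in
  add_J4 f2 [::].

(* The components of an element of [Lambda4_7] with [xor] of the indices equal
   to [v] agree up to the signs [sign4]. *)
Definition sign2 (a b : nat) : Z :=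
  if eqn a 0 then 1%ZZ else if eqn b 0 then (-1)%ZZ
  else (- sign 0 (xor a b) a)%ZZ.

(** For nonzero [v = xor a b], [sign2 a b] is the component [ab] of the 2-form
    [e^0 /\ e^v - Phi_0v..], a multiple of the projection of [e^0 /\ e^v] to the 7-dimensional
    summand of [Lambda^2]. With [p] the fourth point of the plane of [b c d], [sign4] is the single
    term [omega_ap Phi_pbcd] of the action of this 2-form [omega] on [Phi]. That term need not
    vanish when [a] is one of [b], [c], [d], so this case is set to 0 explicitly. *)
Definition sign4 (a b c d : nat) : Z :=
  let p := fourth b c d in
  if [|| eqn a p, eqn a b, eqn a c | eqn a d] then 0%ZZ
  else (sign2 a p * sign b c d)%ZZ.

Definition xor4 (a b c d : nat) : nat := xor (fourth a b c) d.

(** One representative for each value of [xor4]. The increasing quadruples with value 0 are the 14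
    planes, whose components vanish on [Lambda4_7]; accordingly [sign_base 0] is 0. *)
Definition base (v : nat) : seq nat :=
  nth [::] [:: [:: 0; 1; 2; 3]; [:: 0; 2; 4; 7]; [:: 0; 1; 4; 7];
               [:: 0; 1; 4; 6]; [:: 0; 1; 2; 7]; [:: 0; 1; 2; 6];
               [:: 0; 1; 2; 5]; [:: 0; 1; 2; 4]]%N v.

Definition sign_base (v : nat) : Z :=
  if base v is [:: a; b; c; d] then sign4 a b c d else 0%ZZ.

Definition increasing4 (a b c d : nat) : bool := [&& a < b, b < c & c < d]%N.

(** Sorting the indices changes [sign4] by the sign of the sorting permutation and preserves [xor4].
    This extends relations between components with increasing indices to all indices. *)
Lemma sign4_check :
  all8 (fun a => all8 (fun b => all8 (fun c => all8 (fun d =>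
    match add_term 1 a b c d [::] with
    | [::] => Z.eqb (sign4 a b c d) 0
    | [:: ([:: a'; b'; c'; d'], s)] =>
        [&& increasing4 a' b' c' d', (d' < 8)%N,
            Z.eqb (sign4 a b c d) (s * sign4 a' b' c' d')
          & eqn (xor4 a b c d) (xor4 a' b' c' d')]
    | _ => false
    end)))).
Proof. by vm_compute. Qed.

(** A linear form that vanishes on the eigenspace is sent to zero by the projection. Thus each
    component is compared with the representative of its class by normalising the projected
    difference. *)
Lemma project_check :
  all8 (fun a => all8 (fun b => all8 (fun c => all8 (fun d =>
    increasing4 a b c d ==>
    null_form (project
      (insert 1 [:: a; b; c; d]
         (insert (- (sign4 a b c d * sign_base (xor4 a b c d)))
                 (base (xor4 a b c d)) [::]))))))).
Proof. by vm_compute. Qed.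

Section Reflection.
Variable R : realType.
Local Notation zr := (zr R).

Section Eval.
Variable x : seq nat -> R.

Definition eval (f : form) : R := \sum_(m <- f) zr m.2 * x m.1.

Lemma compare_key_eq k l : compare_key k l = Eq -> k = l.
Proof.
elim: k l => [|a k IHk] [|b l] //=; rewrite eqnE.
by case: eqP => [-> /IHk ->|_] //; case: ifP.
Qed.

Lemma eval_nil : eval [::] = 0.
Proof. exact: big_nil. Qed.

Lemma eval_cons m f : eval (m :: f) = zr m.2 * x m.1 + eval f.
Proof. exact: big_cons. Qed.

Lemma eval_insert z k f : eval (insert z k f) = zr z * x k + eval f.
Proof.
elim: f => [|m f IHf] /=; first by rewrite eval_cons.
case cmp: (compare_key k m.1); rewrite !eval_cons //=.
  by rewrite (compare_key_eq cmp) zrD mulrDl addrA.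
by rewrite IHf addrCA.
Qed.

Lemma eval_add_form z g f : eval (add_form z g f) = zr z * eval g + eval f.
Proof.
elim: g => [|m g IHg] /=; first by rewrite eval_nil mulr0 add0r.
by rewrite eval_insert IHg eval_cons zrM mulrDr mulrA addrA.
Qed.

Lemma eval_null_form f : null_form f -> eval f = 0.
Proof.
elim: f => [|m f IHf] /=; first by rewrite eval_nil.
by case/andP=> /Z.eqb_eq m0 /IHf f0; rewrite eval_cons m0 f0 mul0r addr0.
Qed.

End Eval.

Section AlternatingFour.
Variable X : nat -> nat -> nat -> nat -> R.
Hypothesis X01 : forall a b c d, X a b c d = - X b a c d.
Hypothesis X12 : forall a b c d, X a b c d = - X a c b d.
Hypothesis X23 : forall a b c d, X a b c d = - X a b d c.

Definition env4 (k : seq nat) : R :=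
  if k is [:: a; b; c; d] then X a b c d else 0.

Local Notation eval := (eval env4).

Lemma eq_opp0 (y : R) : y = - y -> y = 0.
Proof. by move=> yE; lra. Qed.

Lemma eval_swap_term (G : nat -> nat -> R) z x y f k :
  (forall z x y, eval (k z x y) = zr z * G x y + eval f) ->
  (forall x y, G x y = - G y x) ->
  eval (swap_term z x y f k) = zr z * G x y + eval f.
Proof.
move=> evalk GN; rewrite /swap_term; case: ifP => // _.
rewrite eqnE; case: eqP => [<-|_].
  by rewrite (eq_opp0 (GN x x)) mulr0 add0r.
by rewrite evalk zrN mulNr (GN y) mulrN opprK.
Qed.

Lemma eval_add_term z a b c d f :
  eval (add_term z a b c d f) = zr z * X a b c d + eval f.
Proof.
rewrite /add_term; case: Z.eqb_spec => [->|_]; first by rewrite mul0r add0r.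
apply: (eval_swap_term (G := fun a b => X a b c d)) => // {}z {}a {}b.
apply: (eval_swap_term (G := fun b c => X a b c d)) => // {}z {}b {}c.
apply: (eval_swap_term (G := fun c d => X a b c d)) => // {}z {}c {}d.
apply: (eval_swap_term (G := fun a b => X a b c d)) => // {}z {}a {}b.
apply: (eval_swap_term (G := fun b c => X a b c d)) => // {}z {}b {}c.
apply: (eval_swap_term (G := fun a b => X a b c d)) => // {}z {}a {}b.
by rewrite eval_insert.
Qed.

Definition half a b c d : R :=
  \sum_(p <- I8) zr (sign a b p) * X c d p (fourth a b p).

Hypothesis X_eigen : forall a b c d,
  (a < 8)%N -> (b < 8)%N -> (c < 8)%N -> (d < 8)%N ->
  half a b c d + half c d a b = - 4 * X a b c d.

Lemma eval_add_half z a b c d f :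
  eval (add_half z a b c d f) = zr z * half a b c d + eval f.
Proof.
rewrite /add_half /half; elim: I8 => [|p s IHs] /=.
  by rewrite big_nil mulr0 add0r.
by rewrite big_cons eval_add_term IHs zrM mulrDr mulrA addrA.
Qed.

(** Each of the three unordered splittings contributes -4 times the component by [X_eigen], the
    signs compensating the reordering of the indices; together this is -12. *)
Lemma eval_add_row z k f :
  eval (add_row z k f) = - 12 * (zr z * env4 k) + eval f.
Proof.
have evalN12 : eval (insert (-12 * z) k f) = - 12 * (zr z * env4 k) + eval f.
  by rewrite eval_insert zrM -[(-12)%ZZ]/(- Z.of_nat 12)%ZZ zrN zr_nat mulrA.
case: k evalN12 => [|a [|b [|c [|d [|]]]]] //= evalN12.
case: ifP => // /and4P[a8 b8 c8 d8].
rewrite /add_contraction !eval_add_half zrN.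
have -> : - 12 * (zr z * X a b c d) = zr z * (- 12 * X a b c d) by ring.
have <- : (half a b c d + half c d a b) - (half a c b d + half b d a c)
          + (half a d b c + half b c a d) = - 12 * X a b c d.
  rewrite !X_eigen // (X12 a d) (X23 a b d) (X12 a c); ring.
ring.
Qed.

Lemma eval_add_J4 g f : eval (add_J4 g f) = - 12 * eval g + eval f.
Proof.
elim: g => [|m g IHg] /=; first by rewrite eval_nil mulr0 add0r.
by rewrite eval_add_row IHg eval_cons mulrDr addrA.
Qed.

Lemma eval_project f : eval (project f) = 2304 * eval f.
Proof.
rewrite /project !(eval_add_J4, eval_add_form, eval_nil).
rewrite -[24%ZZ]/(Z.of_nat 24) -[(-4)%ZZ]/(- Z.of_nat 4)%ZZ zrN !zr_nat.
by ring.
Qed.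

Definition reduced (v : nat) : R := zr (sign_base v) * env4 (base v).

(** On a tensor satisfying [X_eigen], the projection multiplies the value of a form by 2304. A form
    with zero projection therefore evaluates to zero, and [project_check] becomes a relation between
    the components of [X]. *)
Lemma components_reduced a b c d :
  (a < 8)%N -> (b < 8)%N -> (c < 8)%N -> (d < 8)%N ->
  X a b c d = zr (sign4 a b c d) * reduced (xor4 a b c d).
Proof.
have incr a' b' c' d' : increasing4 a' b' c' d' -> (d' < 8)%N ->
    X a' b' c' d' = zr (sign4 a' b' c' d') * reduced (xor4 a' b' c' d').
  move=> inc d8; have /and3P[ab bc cd] := inc.
  have c8 := ltn_trans cd d8; have b8 := ltn_trans bc c8.
  have a8 := ltn_trans ab b8.
  have /all8P/(_ _ a8)/all8P/(_ _ b8)/all8P/(_ _ c8)/all8P/(_ _ d8) :=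
    project_check.
  move=> /implyP/(_ inc)/eval_null_form-/(_ env4); rewrite eval_project.
  move=> /eqP; rewrite mulf_eq0 pnatr_eq0 => /orP[//|/eqP].
  rewrite !eval_insert eval_nil zr1 zrN zrM /= /reduced; lra.
move=> a8 b8 c8 d8.
have /all8P/(_ _ a8)/all8P/(_ _ b8)/all8P/(_ _ c8)/all8P/(_ _ d8) :=
  sign4_check.
have := eval_add_term 1 a b c d [::]; rewrite zr1 mul1r eval_nil addr0.
case: add_term => [|[[|a' [|b' [|c' [|d' [|? ?]]]]] s] [|? ?]] //=.
  by rewrite eval_nil => <- /Z.eqb_eq ->; rewrite zr0 mul0r.
rewrite eval_cons eval_nil addr0 /= => <-.
case/and4P=> /incr X' /X' -> /Z.eqb_eq ->; rewrite eqnE => /eqP ->.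
by rewrite zrM mulrA.
Qed.

End AlternatingFour.
End Reflection.

(** * Alternation *)

Section Alternation.
Variables (R : realType) (n : nat).

Lemma permuteM k (s r : 'S_k) (t : k.-tuple 'I_n) :
  permute s (permute r t) = permute (s * r)%g t.
Proof. by apply: eq_from_tnth => i; rewrite !tnth_mktuple permM. Qed.

Lemma permute1 k (t : k.-tuple 'I_n) : permute 1%g t = t.
Proof. by apply: eq_from_tnth => i; rewrite tnth_mktuple perm1. Qed.

Lemma permuteK k (s : 'S_k) : cancel (permute s) (@permute n k s^-1%g).
Proof. by move=> t; rewrite permuteM mulVg permute1. Qed.

Lemma alt_permute k (T : tensor R n k) (s : 'S_k) t :
  alt (fun u => T (permute s u)) t = (-1) ^+ s * alt T t.
Proof.
rewrite /alt mulrCA; congr (_ * _).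
rewrite (reindex_inj (mulgI s^-1%g)) mulr_sumr; apply: eq_bigr => r _ /=.
by rewrite permuteM mulgA mulgV mul1g odd_permM odd_permV signr_addb mulrA.
Qed.

Lemma alternating_alt k (T : tensor R n k) : alternating (alt T).
Proof.
move=> s t; rewrite /alt mulrCA; congr (_ * _).
rewrite (reindex_inj (mulIg s^-1%g)) mulr_sumr; apply: eq_bigr => r _ /=.
by rewrite permuteM -mulgA mulVg mulg1 odd_permM odd_permV signr_addb mulrA
  [X in X * _]mulrC.
Qed.

Lemma alt_alternating k (T : tensor R n k) : alternating T -> alt T =1 T.
Proof.
move=> altT t; rewrite /alt (eq_bigr (fun=> T t)) => [|s _]; last first.
  by rewrite altT mulrA -signr_addb addbb mul1r.
rewrite sumr_const card_Sn -[T t *+ _]mulr_natl mulrA mulVf ?mul1r //=.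
Qed.

Lemma eq_alt k (T T' : tensor R n k) : T =1 T' -> alt T =1 alt T'.
Proof.
by move=> eqT t; rewrite /alt; under eq_bigr => s _ do rewrite eqT.
Qed.

Lemma altD k (T T' : tensor R n k) t :
  alt (fun u => T u + T' u) t = alt T t + alt T' t.
Proof.
by rewrite /alt (eq_bigr _ (fun s _ => mulrDr _ _ _)) big_split mulrDr.
Qed.

Lemma altZ k (c : R) (T : tensor R n k) t :
  alt (fun u => c * T u) t = c * alt T t.
Proof.
rewrite /alt mulrCA [c * _]mulr_sumr; congr (_ * _).
by apply: eq_bigr => s _; rewrite mulrCA.
Qed.

Lemma altB k (T T' : tensor R n k) t :
  alt (fun u => T u - T' u) t = alt T t - alt T' t.
Proof.
rewrite -mulN1r -altZ -altD; apply: eq_alt => u; by rewrite mulN1r.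
Qed.

Lemma tperm_tuple k (i j : 'I_k) (t t' : k.-tuple 'I_n) (T : tensor R n k) :
  alternating T -> i != j -> tnth t i = tnth t' j -> tnth t j = tnth t' i ->
  (forall r, r != i -> r != j -> tnth t r = tnth t' r) -> T t = - T t'.
Proof.
move=> altT neq_ij ti tj tr.
have -> : t = permute (tperm i j) t'.
  apply: eq_from_tnth => r; rewrite tnth_mktuple.
  by case: tpermP => [->|->|/eqP ri /eqP rj] //; apply: tr.
by rewrite altT odd_tperm neq_ij expr1 mulN1r.
Qed.

End Alternation.

(** A permutation amounts to the image of 0 together with the permutation induced on the remaining
    points. Iterating this lists the elements of ['S_3] with their signs. *)
Lemma big_perm_lift (R : nmodType) k (F : 'S_k.+1 -> R) :
  \sum_(s : 'S_k.+1) F s =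
  \sum_(i < k.+1) \sum_(s : 'S_k) F (lift_perm ord0 i s).
Proof.
rewrite (partition_big (fun s : 'S_k.+1 => s ord0) predT) //=.
apply: eq_bigr => i _.
rewrite (reindex (lift_perm ord0 i)); last first.
  (* The induced map on the remaining points. The default [r] never occurs, since [s] sends
     [lift ord0 r] to a point other than [s ord0]. *)
  pose ulsf (s : 'S_k.+1) r := odflt r (unlift (s ord0) (s (lift ord0 r))).
  have ulsfK (s : 'S_k.+1) r : lift (s ord0) (ulsf s r) = s (lift ord0 r).
    rewrite /ulsf; have: s ord0 != s (lift ord0 r).
      by rewrite (inj_eq perm_inj) neq_lift.
    by case/unlift_some=> ? ? ->.
  have inj_ulsf s : injective (ulsf s).
    move=> r r' /(congr1 (lift (s ord0))); rewrite !ulsfK.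
    by move/perm_inj/lift_inj.
  exists (fun s => perm (inj_ulsf s)) => [s _|s].
    apply/permP => r; rewrite permE /ulsf lift_perm_id lift_perm_lift.
    by rewrite liftK.
  rewrite inE => /eqP s0; apply/permP => r.
  case: (unliftP ord0 r) => [r'|] ->; last by rewrite lift_perm_id.
  by rewrite lift_perm_lift permE -{1}s0 ulsfK.
by apply: eq_bigl => s; rewrite lift_perm_id eqxx.
Qed.

Lemma alt3E (R : realType) n (T : tensor R n 3) a b c :
  alt T [tuple a; b; c] =
  6^-1 * (T [tuple a; b; c] - T [tuple a; c; b] - T [tuple b; a; c]
          + T [tuple b; c; a] + T [tuple c; a; b] - T [tuple c; b; a]).
Proof.
rewrite /alt; congr (_ * _).
have pE (s : 'S_3) : permute s [tuple a; b; c] =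
    let e i := nth a [:: a; b; c] (s i) in
    [tuple e ord0; e (lift ord0 ord0); e (lift ord0 (lift ord0 ord0))].
  apply: eq_from_tnth => r; rewrite tnth_mktuple (tnth_nth a) /=.
  have [-> //|[->|->] //] : r = ord0 \/ r = lift ord0 ord0 \/
      r = lift ord0 (lift ord0 ord0).
  case: r => -[|[|[|//]]] lt_r; [left|right; left|right; right];
    exact: val_inj.
have S0 (F : 'S_0 -> R) : \sum_s F s = F 1%g.
  by rewrite (big_pred1 1%g) // => s; apply/esym/eqP; apply: permS0.
rewrite !big_perm_lift !big_ord_recl !big_ord0 !big_perm_lift.
rewrite !big_ord_recl !big_ord0 !big_perm_lift !big_ord_recl !big_ord0 !S0.
rewrite !pE /= !(lift_perm_id, lift_perm_lift) /= !odd_lift_perm !odd_perm1 /=.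
by rewrite !expr1 !expr0 !mul1r !mulN1r; ring.
Qed.

(** * Reflection of the torsion formula in the reduced unknowns *)

Definition add_comp (z : Z) (i a b c d : nat) (f : form) : form :=
  let s := (z * sign4 a b c d)%ZZ in
  if Z.eqb s 0 then f else insert s [:: i; xor4 a b c d] f.

Definition add_div (z : Z) (a b c : nat) (f : form) : form :=
  foldr (fun p f => add_comp z p p a b c f) f I8.

Definition add_div_phi (z : Z) (a b c : nat) (f : form) : form :=
  foldr (fun p f => add_div (z * sign b c p) a p (fourth b c p) f) f I8.

(** The coefficients are -5/12 and -1/8 times 24. As [torsion_form] also omits the factor 1/6 of the
    alternation, it represents 144 times the torsion. *)
Definition add_pretorsion (z : Z) (a b c : nat) (f : form) : form :=
  add_div (-10 * z) a b c (add_div_phi (-3 * z) a b c f).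

Definition torsion_form (a b c : nat) : form :=
  add_pretorsion 1 a b c (add_pretorsion (-1) a c b (
  add_pretorsion (-1) b a c (add_pretorsion 1 b c a (
  add_pretorsion 1 c a b (add_pretorsion (-1) c b a [::]))))).

Definition torsion_table : seq (seq (seq form)) :=
  [seq [seq [seq [seq m <- torsion_form i j k | ~~ Z.eqb m.2 0]
       | k <- I8] | j <- I8] | i <- I8].

Definition torsion_at (i j k : nat) : form :=
  nth [::] (nth [::] (nth [::] torsion_table i) j) k.

(** The minus sign comes from [Phi_pbcd = - Phi_bcdp], a 4-cycle being odd; the rotated form has the
    summed index last, where it is determined by the others. *)
Definition add_action (z : Z) (i a b c d : nat) (f : form) : form :=
  add_form (z * - sign b c d) (torsion_at i a (fourth b c d)) f.

(** The identity to which the second claim reduces: the four terms are the action of [T] on [Phi],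
    antisymmetrised over the position of [a], and 144 clears the denominators. *)
Lemma torsion_check :
  all8 (fun i => all8 (fun a => all8 (fun b => all8 (fun c => all8 (fun d =>
    null_form (add_comp (-144) i a b c d
      (add_action 1 i a b c d (add_action (-1) i b a c d
      (add_action (-1) i c b a d (add_action (-1) i d b c a [::])))))))))).
Proof. by vm_compute. Qed.

Lemma phi_rotate_check :
  all8 (fun a => all8 (fun b => all8 (fun c => all8 (fun d =>
    Z.eqb (phi a b c d) (- phi b c d a))))).
Proof. by vm_compute. Qed.

Section TorsionReflection.
Variables (R : realType) (y : nat -> nat -> R).
Local Notation zr := (zr R).

Definition env2 (k : seq nat) : R := if k is [:: i; v] then y i v else 0.

Local Notation eval := (eval env2).

Definition comp (i a b c d : nat) : R :=
  zr (sign4 a b c d) * y i (xor4 a b c d).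

Definition div (a b c : nat) : R := \sum_(p <- I8) comp p p a b c.

Definition div_phi (a b c : nat) : R :=
  \sum_(p <- I8) zr (sign b c p) * div a p (fourth b c p).

Definition pretorsion (a b c : nat) : R := - 10 * div a b c - 3 * div_phi a b c.

Definition torsion_nat (a b c : nat) : R :=
  pretorsion a b c - pretorsion a c b - pretorsion b a c
  + pretorsion b c a + pretorsion c a b - pretorsion c b a.

Lemma eval_foldr (F : nat -> form -> form) (G : nat -> R) z s f :
  (forall p f, eval (F p f) = zr z * G p + eval f) ->
  eval (foldr F f s) = zr z * (\sum_(p <- s) G p) + eval f.
Proof.
move=> evalF; elim: s => [|p s IHs] /=; first by rewrite big_nil mulr0 add0r.
by rewrite big_cons evalF IHs mulrDr addrA.
Qed.

Lemma eval_add_comp z i a b c d f :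
  eval (add_comp z i a b c d f) = zr z * comp i a b c d + eval f.
Proof.
rewrite /add_comp /comp mulrA -zrM; case: Z.eqb_spec => [->|_].
  by rewrite mul0r add0r.
by rewrite eval_insert.
Qed.

Lemma eval_add_div z a b c f :
  eval (add_div z a b c f) = zr z * div a b c + eval f.
Proof. by apply: eval_foldr => p {}f; rewrite eval_add_comp. Qed.

Lemma eval_add_div_phi z a b c f :
  eval (add_div_phi z a b c f) = zr z * div_phi a b c + eval f.
Proof.
by apply: eval_foldr => p {}f; rewrite eval_add_div zrM mulrA.
Qed.

Lemma eval_add_pretorsion z a b c f :
  eval (add_pretorsion z a b c f) = zr z * pretorsion a b c + eval f.
Proof.
rewrite eval_add_div eval_add_div_phi !zrM -[(-10)%ZZ]/(- Z.of_nat 10)%ZZ.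
rewrite -[(-3)%ZZ]/(- Z.of_nat 3)%ZZ !zrN !zr_nat /pretorsion; ring.
Qed.

Lemma eval_filter f :
  eval [seq m <- f | ~~ Z.eqb m.2 0] = eval f.
Proof.
elim: f => [|m f IHf] //=; rewrite eval_cons -IHf.
by case: Z.eqb_spec => [->|_]; rewrite /= ?eval_cons // mul0r add0r.
Qed.

Lemma eval_torsion_at a b c : (a < 8)%N -> (b < 8)%N -> (c < 8)%N ->
  eval (torsion_at a b c) = torsion_nat a b c.
Proof.
move=> a8 b8 c8; have nthI8 i : (i < 8)%N -> nth 0%N I8 i = i.
  by move=> i8; rewrite -[I8]/(iota 0 8) nth_iota.
rewrite /torsion_at /torsion_table (nth_map 0%N) // (nth_map 0%N) //.
rewrite (nth_map 0%N) // !nthI8 // eval_filter /torsion_form.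
rewrite !eval_add_pretorsion eval_nil -[(-1)%ZZ]/(- Z.of_nat 1)%ZZ zrN.
rewrite zr_nat ?zr1 /torsion_nat; ring.
Qed.

Lemma comp_torsion i a b c d :
  (i < 8)%N -> (a < 8)%N -> (b < 8)%N -> (c < 8)%N -> (d < 8)%N ->
  let act a b c d := - zr (sign b c d) * torsion_nat i a (fourth b c d) in
  144 * comp i a b c d = act a b c d - act b a c d - act c b a d - act d b c a.
Proof.
move=> i8 a8 b8 c8 d8 act.
have evalA z a' b' c' d' f : (a' < 8)%N -> (b' < 8)%N -> (c' < 8)%N ->
    (d' < 8)%N ->
    eval (add_action z i a' b' c' d' f) = zr z * act a' b' c' d' + eval f.
  move=> ? ? ? ?; rewrite eval_add_form eval_torsion_at //; last first.
    exact: fourth_lt.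
  by rewrite zrM zrN mulrA.
have /all8P/(_ _ i8)/all8P/(_ _ a8)/all8P/(_ _ b8) := torsion_check.
move=> /all8P/(_ _ c8)/all8P/(_ _ d8)/eval_null_form-/(_ _ env2).
rewrite eval_add_comp !evalA // eval_nil -[(-1)%ZZ]/(- Z.of_nat 1)%ZZ.
rewrite -[(-144)%ZZ]/(- Z.of_nat 144)%ZZ !zrN !zr_nat ?zr1; lra.
Qed.

End TorsionReflection.

(** * The torsion 3-form *)

Section Contractions.
Variables (R : realType) (n : nat).

(** Sums and factors are ordered as in [J4], so that the two expressions agree by conversion. *)
Definition contract2 (h : 'M[R]_n) (F G : 'I_n -> 'I_n -> R) : R :=
  \sum_p \sum_q \sum_r \sum_s F r s * h r p * h s q * G p q.

Definition divergence k (h : 'M[R]_n) (X : 'I_n -> tensor R n k.+1) :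
    tensor R n k :=
  fun t => \sum_p \sum_q h p q * X p (cons_tuple q t).

Lemma sum_delta_l (i : 'I_n) (F : 'I_n -> R) :
  \sum_j (1%:M : 'M[R]_n) i j * F j = F i.
Proof.
rewrite (bigD1 i) //= !mxE eqxx mul1r big1 ?addr0 // => j.
by rewrite !mxE eq_sym => /negbTE ->; rewrite mul0r.
Qed.

Lemma sum_delta_r (i : 'I_n) (F : 'I_n -> R) :
  \sum_j F j * (1%:M : 'M[R]_n) j i = F i.
Proof.
rewrite (bigD1 i) //= !mxE eqxx mulr1 big1 ?addr0 // => j.
by rewrite !mxE => /negbTE ->; rewrite mulr0.
Qed.

Lemma contract2_1 (F G : 'I_n -> 'I_n -> R) :
  contract2 1%:M F G = \sum_p \sum_q F p q * G p q.
Proof.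
apply: eq_bigr => p _; apply: eq_bigr => q _.
under eq_bigr => r _ do rewrite -mulr_suml sum_delta_r mulrAC.
by rewrite sum_delta_r.
Qed.

Lemma divergence_1 k (X : 'I_n -> tensor R n k.+1) t :
  divergence 1%:M X t = \sum_p X p (cons_tuple p t).
Proof. by apply: eq_bigr => p _; rewrite sum_delta_l. Qed.

End Contractions.

Definition torsion3 (R : realType) (h : 'M[R]_8) (Phi : tensor R 8 4)
    (X : 'I_8 -> tensor R 8 4) : tensor R 8 3 :=
  alt (fun u => - (5 / 12) * divergence h X u
    - 8^-1 * contract2 h (fun r s => divergence h X [tuple tnth u 0; r; s])
        (fun p q => Phi [tuple tnth u 1; tnth u 2; p; q])).

Section FlatTorsion.
Variables (R : realType) (X : 'I_8 -> tensor R 8 4).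
Local Notation Phi0 := (cayley0 R).

Hypothesis altX : forall i, alternating (X i).
Hypothesis X_eigen : forall i a b c d,
  \sum_p \sum_q Phi0 [tuple a; b; p; q] * X i [tuple c; d; p; q]
  + \sum_p \sum_q Phi0 [tuple c; d; p; q] * X i [tuple a; b; p; q]
  = - 4 * X i [tuple a; b; c; d].

(** Extending by [inord] keeps the antisymmetry valid for all natural indices, as the reflection
    lemmas require. *)
Let Xn i a b c d : R :=
  X (inord i) [tuple inord a; inord b; inord c; inord d].
Let y i := reduced (Xn i).

Lemma compE (i a b c d : 'I_8) : X i [tuple a; b; c; d] = comp y i a b c d.
Proof.
rewrite /comp /y -components_reduced //; first by rewrite /Xn !inord_val.
- move=> {}a {}b {}c {}d; apply: (tperm_tuple (i := 0) (j := 1)) => //.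
  by case=> -[|[|[|[|//]]]].
- move=> {}a {}b {}c {}d; apply: (tperm_tuple (i := 1) (j := 2)) => //.
  by case=> -[|[|[|[|//]]]].
- move=> {}a {}b {}c {}d; apply: (tperm_tuple (i := 2) (j := 3)) => //.
  by case=> -[|[|[|[|//]]]].
have halfE (a' b' c' d' : 'I_8) : half (Xn i) a' b' c' d' =
    \sum_p \sum_q Phi0 [tuple a'; b'; p; q] * X i [tuple c'; d'; p; q].
  rewrite /half sum_I8; apply: eq_bigr => p _.
  by rewrite sum_cayley0 /Xn !inord_val.
move=> a' b' c' d' a8 b8 c8 d8.
rewrite -[a'](inordK a8) -[b'](inordK b8) -[c'](inordK c8) -[d'](inordK d8).
by rewrite !halfE X_eigen /Xn !inord_val.
Qed.

Lemma divE (a b c : 'I_8) :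
  div y a b c = divergence 1%:M X [tuple a; b; c].
Proof.
rewrite divergence_1 /div sum_I8; apply: eq_bigr => p _; rewrite -compE.
by congr (X p _); apply: val_inj.
Qed.

Lemma div_phiE (a b c : 'I_8) :
  div_phi y a b c =
  contract2 1%:M (fun r s => divergence 1%:M X [tuple a; r; s])
    (fun p q => Phi0 [tuple b; c; p; q]).
Proof.
rewrite contract2_1 /div_phi sum_I8; apply: eq_bigr => p _.
under eq_bigr => q _ do rewrite mulrC.
by rewrite sum_cayley0 -divE inordK // fourth_lt.
Qed.

Lemma torsion_natE (a b c : 'I_8) :
  torsion_nat y a b c = 144 * torsion3 1%:M Phi0 X [tuple a; b; c].
Proof.
by rewrite /torsion3 alt3E /torsion_nat /pretorsion !divE !div_phiE; field.
Qed.

Lemma flat_torsion i a b c d :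
  let act a b c d := \sum_p torsion3 1%:M Phi0 X [tuple i; a; p] *
                            Phi0 [tuple p; b; c; d] in
  X i [tuple a; b; c; d] =
  act a b c d - act b a c d - act c b a d - act d b c a.
Proof.
move=> act; have actE (a' b' c' d' : 'I_8) :
    - zr R (sign b' c' d') * torsion_nat y i a' (fourth b' c' d') =
    144 * act a' b' c' d'.
  have rot (p : 'I_8) :
      Phi0 [tuple p; b'; c'; d'] = - Phi0 [tuple b'; c'; d'; p].
    rewrite !cayley0E -zrN; congr (zr R _); apply/Z.eqb_eq.
    have /all8P/(_ _ (ltn_ord p))/all8P/(_ _ (ltn_ord b')) := phi_rotate_check.
    by move=> /all8P/(_ _ (ltn_ord c'))/all8P/(_ _ (ltn_ord d')).
  rewrite /act; under eq_bigr => p _ do rewrite rot mulrN mulrC.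
  rewrite sumrN sum_cayley0 mulrN mulrCA -torsion_natE inordK ?mulNr //.
  exact: fourth_lt.
have := comp_torsion y (ltn_ord i) (ltn_ord a) (ltn_ord b) (ltn_ord c)
  (ltn_ord d).
by rewrite /= -compE !actE; lra.
Qed.

End FlatTorsion.

(** * Naturality *)

Section Pullback.
Variables (R : realType) (n : nat).
Implicit Types (A B h : 'M[R]_n).

Lemma big_cons_tuple k (F : k.+1.-tuple 'I_n -> R) :
  \sum_(u : k.+1.-tuple 'I_n) F u =
  \sum_(i < n) \sum_(u : k.-tuple 'I_n) F (cons_tuple i u).
Proof.
rewrite pair_big /=.
rewrite (reindex (fun p : 'I_n * k.-tuple 'I_n => cons_tuple p.1 p.2)) //.
exists (fun u : k.+1.-tuple 'I_n => (thead u, behead_tuple u)).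
  by move=> [i u] _ /=; congr (_, _); apply: val_inj.
by move=> u _; rewrite [RHS]tuple_eta; apply: val_inj.
Qed.

Lemma tnth_cons0 (T : Type) k (x : T) (t : k.-tuple T) :
  tnth (cons_tuple x t) ord0 = x.
Proof. by []. Qed.

Lemma tnth_consS (T : Type) k (x : T) (t : k.-tuple T) i :
  tnth (cons_tuple x t) (lift ord0 i) = tnth t i.
Proof. by rewrite !(tnth_nth x). Qed.

Lemma pullback_cons k A (T : tensor R n k.+1) j t :
  pullback A T (cons_tuple j t) =
  \sum_i A i j * pullback A (fun u => T (cons_tuple i u)) t.
Proof.
rewrite /pullback big_cons_tuple; apply: eq_bigr => i _; rewrite mulr_sumr.
apply: eq_bigr => u _; rewrite big_ord_recl !tnth_cons0 -!mulrA.
by congr (_ * (_ * _)); apply: eq_bigr => s _; rewrite !tnth_consS.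
Qed.

Lemma pullback_nil A (T : tensor R n 0) : pullback A T =1 T.
Proof.
move=> t; rewrite /pullback (big_pred1 t) => [|u].
  by rewrite big_ord0 mul1r.
by apply/esym/eqP; rewrite tuple0 [RHS]tuple0.
Qed.

Lemma eq_pullback k A (T T' : tensor R n k) :
  T =1 T' -> pullback A T =1 pullback A T'.
Proof. by move=> eqT t; apply: eq_bigr => u _; rewrite eqT. Qed.

Lemma pullback_sum (I : finType) k A (T : I -> tensor R n k) t :
  pullback A (fun u => \sum_i T i u) t = \sum_i pullback A (T i) t.
Proof.
rewrite /pullback; under eq_bigr => u _ do rewrite mulr_sumr.
exact: exchange_big.
Qed.

Lemma pullbackZ k A c (T : tensor R n k) t :
  pullback A (fun u => c * T u) t = c * pullback A T t.
Proof.
by rewrite /pullback mulr_sumr; apply: eq_bigr => u _; rewrite mulrCA.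
Qed.

Lemma pullbackD k A (T T' : tensor R n k) t :
  pullback A (fun u => T u + T' u) t = pullback A T t + pullback A T' t.
Proof.
by rewrite /pullback -big_split; apply: eq_bigr => u _; rewrite mulrDr.
Qed.

(** Separating the indices into blocks isolates those that get contracted, while the free indices
    stay under an outer pullback. *)
Lemma pullback_cat k l A (T : tensor R n (k + l)) t t' :
  pullback A T (cat_tuple t t') =
  pullback A (fun u => pullback A (fun u' => T (cat_tuple u u')) t') t.
Proof.
elim: k T t => [|k IHk] T t.
  rewrite pullback_nil (tuple0 t).
  have -> : cat_tuple [tuple] t' = t' by apply: val_inj.
  by apply: eq_pullback => u; congr T; apply: val_inj.
case/tupleP: t => j t.
have -> : cat_tuple [tuple of j :: t] t' = cons_tuple j (cat_tuple t t').
  exact: val_inj.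
rewrite !pullback_cons; apply: eq_bigr => i _; congr (_ * _); rewrite IHk.
apply: eq_pullback => u; apply: eq_pullback => u'; congr T; exact: val_inj.
Qed.

Lemma pullbackM k A B (T : tensor R n k) :
  pullback B (pullback A T) =1 pullback (A *m B) T.
Proof.
elim: k T => [|k IHk] T t; first by rewrite !pullback_nil.
case/tupleP: t => j t; rewrite !pullback_cons.
under eq_bigr => i _.
  rewrite (eq_pullback B (T' := fun u => \sum_l A l i *
    pullback A (fun v => T (cons_tuple l v)) u)) => [|u]; last first.
    by rewrite pullback_cons.
  rewrite pullback_sum mulr_sumr.
  under eq_bigr => l _ do rewrite pullbackZ IHk.
  over.
rewrite exchange_big; apply: eq_bigr => l _; rewrite mxE mulr_suml.
by apply: eq_bigr => i _ /=; rewrite mulrA [B _ _ * _]mulrC.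
Qed.

Lemma pullback1 k (T : tensor R n k) : pullback 1%:M T =1 T.
Proof.
elim: k T => [|k IHk] T t; first exact: pullback_nil.
case/tupleP: t => j t; rewrite pullback_cons.
rewrite (bigD1 j) //= mxE eqxx mul1r IHk big1 ?addr0 // => i.
by rewrite mxE => /negbTE ->; rewrite mul0r.
Qed.

Lemma pullback_permute k A (T : tensor R n k) (s : 'S_k) t :
  pullback A T (permute s t) = pullback A (fun u => T (permute s u)) t.
Proof.
rewrite /pullback (reindex_inj (can_inj (permuteK s))).
apply: eq_bigr => u _; congr (_ * _).
rewrite [RHS](reindex_inj (@perm_inj _ s)).
by apply: eq_bigr => r _; rewrite !tnth_mktuple.
Qed.

Lemma alternating_pullback k A (T : tensor R n k) :
  alternating T -> alternating (pullback A T).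
Proof.
move=> altT s t; rewrite pullback_permute -pullbackZ.
by apply: eq_pullback => u; rewrite altT.
Qed.

Lemma alt_pullback k A (T : tensor R n k) :
  alt (pullback A T) =1 pullback A (alt T).
Proof.
move=> t; rewrite /alt pullbackZ pullback_sum; congr (_ * _).
by apply: eq_bigr => s _; rewrite pullbackZ pullback_permute.
Qed.

(** Upper indices transform against lower ones: pulling back two contracted slots by [A] amounts to
    pushing the inverse metric forward to [A h A^T]. All naturality statements reduce to this. *)
Lemma contract_pullback A h (P : 'I_n -> 'I_n -> R) :
  \sum_p \sum_q h p q * (\sum_i A i p * \sum_j A j q * P i j) =
  \sum_i \sum_j (A *m h *m A^T) i j * P i j.
Proof.
pose F p q i j := h p q * A i p * A j q * P i j.
transitivity (\sum_p \sum_q \sum_i \sum_j F p q i j).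
  apply: eq_bigr => p _; apply: eq_bigr => q _; rewrite mulr_sumr.
  apply: eq_bigr => i _; rewrite !mulr_sumr; apply: eq_bigr => j _.
  by rewrite /F !mulrA.
under eq_bigr => p _ do rewrite exchange_big; rewrite exchange_big.
apply: eq_bigr => i _ /=.
under eq_bigr => p _ do rewrite exchange_big; rewrite exchange_big.
apply: eq_bigr => j _ /=; rewrite mxE mulr_suml exchange_big.
apply: eq_bigr => q _ /=; rewrite !mxE !mulr_suml; apply: eq_bigr => p _.
by rewrite /F [h p q * _]mulrC.
Qed.

Lemma contract_sum (I : finType) (a : I -> R) h (F : I -> 'I_n -> 'I_n -> R) :
  \sum_p \sum_q h p q * (\sum_i a i * F i p q) =
  \sum_i a i * \sum_p \sum_q h p q * F i p q.
Proof.
under eq_bigr => p _ do under eq_bigr => q _ do rewrite mulr_sumr.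
under eq_bigr => p _ do rewrite exchange_big; rewrite exchange_big.
apply: eq_bigr => i _; rewrite mulr_sumr; apply: eq_bigr => p _ /=.
by rewrite mulr_sumr; apply: eq_bigr => q _; rewrite mulrCA.
Qed.

Lemma divergence_pullback k A h h0 (X X' : 'I_n -> tensor R n k.+1) :
  A *m h *m A^T = h0 ->
  (forall p t, X' p t = \sum_i A i p * pullback A (X i) t) ->
  divergence h X' =1 pullback A (divergence h0 X).
Proof.
move=> <- X'E t; rewrite pullback_sum.
under [RHS]eq_bigr => i _.
  rewrite pullback_sum; under eq_bigr => j _ do rewrite pullbackZ.
  over.
rewrite -contract_pullback; apply: eq_bigr => p _; apply: eq_bigr => q _.
rewrite X'E; congr (_ * _); apply: eq_bigr => i _; congr (_ * _).
exact: pullback_cons.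
Qed.

Lemma pullback_mul k l A (S : tensor R n k) (T : tensor R n l) t t' :
  pullback A (fun u => pullback A (fun u' => S u * T u') t') t =
  pullback A S t * pullback A T t'.
Proof.
rewrite [RHS]mulrC -pullbackZ; apply: eq_pullback => u.
by rewrite pullbackZ mulrC.
Qed.

Lemma pullback_slot k A (S : tensor R n (k + 1)) t q :
  pullback A S (cat_tuple t [tuple q]) =
  \sum_i A i q * pullback A (fun u => S (cat_tuple u [tuple i])) t.
Proof.
rewrite pullback_cat.
rewrite (eq_pullback A (T' := fun u =>
  \sum_i A i q * S (cat_tuple u [tuple i]))).
  by rewrite pullback_sum; apply: eq_bigr => i _; rewrite pullbackZ.
by move=> u; rewrite pullback_cons; apply: eq_bigr => i _; rewrite pullback_nil.
Qed.

Lemma pullback_slot2 k A (S : tensor R n (k + 2)) t r s :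
  pullback A S (cat_tuple t [tuple r; s]) =
  \sum_i A i r * \sum_j A j s *
    pullback A (fun u => S (cat_tuple u [tuple i; j])) t.
Proof.
rewrite pullback_cat (eq_pullback A (T' := fun u => \sum_i A i r * (\sum_j
    A j s * S (cat_tuple u [tuple i; j])))) => [|u].
  rewrite pullback_sum; apply: eq_bigr => i _; rewrite pullbackZ pullback_sum.
  by congr (_ * _); apply: eq_bigr => j _; rewrite pullbackZ.
rewrite pullback_cons; apply: eq_bigr => i _; rewrite pullback_cons.
by congr (_ * _); apply: eq_bigr => j _; rewrite pullback_nil.
Qed.

Lemma contract1_pullback k l A h (S : tensor R n (k + 1))
    (T : tensor R n l.+1) t t' :
  \sum_p \sum_q pullback A S (cat_tuple t [tuple q]) * h q p *
                pullback A T (cons_tuple p t') =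
  pullback A (fun u => pullback A (fun u' => \sum_p \sum_q
    S (cat_tuple u [tuple q]) * (A *m h *m A^T) q p *
    T (cons_tuple p u')) t') t.
Proof.
pose f i := pullback A (fun u => S (cat_tuple u [tuple i])) t.
pose g j := pullback A (fun u => T (cons_tuple j u)) t'.
transitivity (\sum_i \sum_j (A *m h *m A^T) i j * (f i * g j)).
  rewrite -contract_pullback exchange_big; apply: eq_bigr => q _.
  apply: eq_bigr => p _; rewrite mulrAC mulrC; congr (_ * _).
  rewrite pullback_slot pullback_cons mulr_suml; apply: eq_bigr => i _.
  rewrite -mulrA; congr (_ * _); rewrite mulr_sumr.
  by apply: eq_bigr => j _; rewrite mulrCA.
rewrite exchange_big /=.
rewrite (eq_pullback A (T' := fun u => \sum_j \sum_i (A *m h *m A^T) i j *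
  pullback A (fun u' => S (cat_tuple u [tuple i]) * T (cons_tuple j u')) t')).
  rewrite pullback_sum; apply: eq_bigr => j _; rewrite pullback_sum.
  by apply: eq_bigr => i _; rewrite pullbackZ pullback_mul.
move=> u; rewrite pullback_sum; apply: eq_bigr => j _; rewrite pullback_sum.
apply: eq_bigr => i _; rewrite -pullbackZ; apply: eq_pullback => u'.
by rewrite mulrAC mulrC.
Qed.

Lemma contract2E h (F G : 'I_n -> 'I_n -> R) :
  contract2 h F G =
  \sum_r \sum_p h r p * (\sum_s \sum_q h s q * (F r s * G p q)).
Proof.
rewrite /contract2 [RHS]exchange_big; apply: eq_bigr => p _ /=.
rewrite exchange_big; apply: eq_bigr => r _ /=; rewrite exchange_big mulr_sumr.
apply: eq_bigr => s _ /=; rewrite mulr_sumr; apply: eq_bigr => q _; ring.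
Qed.

Lemma contract2_pullback A h (F G : 'I_n -> 'I_n -> R) :
  contract2 h (fun r s => \sum_i A i r * \sum_j A j s * F i j)
              (fun p q => \sum_i A i p * \sum_j A j q * G i j) =
  contract2 (A *m h *m A^T) F G.
Proof.
rewrite !contract2E -contract_pullback; apply: eq_bigr => r _.
apply: eq_bigr => p _; congr (_ * _).
transitivity (\sum_s \sum_q h s q * (\sum_i A i r * \sum_k A k p *
    \sum_j A j s * \sum_l A l q * (F i j * G k l))).
  apply: eq_bigr => s _; apply: eq_bigr => q _; congr (_ * _).
  rewrite mulr_suml; apply: eq_bigr => i _; rewrite -mulrA; congr (_ * _).
  rewrite mulr_sumr; apply: eq_bigr => k _; rewrite mulrCA; congr (_ * _).
  rewrite mulr_suml; apply: eq_bigr => j _; rewrite -mulrA; congr (_ * _).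
  by rewrite mulr_sumr; apply: eq_bigr => l _; rewrite mulrCA.
rewrite contract_sum; apply: eq_bigr => i _; congr (_ * _).
rewrite contract_sum; apply: eq_bigr => k _; congr (_ * _).
exact: contract_pullback.
Qed.

Lemma eq_contract2 h (F F' G G' : 'I_n -> 'I_n -> R) :
  F =2 F' -> G =2 G' -> contract2 h F G = contract2 h F' G'.
Proof.
move=> eqF eqG; apply: eq_bigr => p _; apply: eq_bigr => q _.
by apply: eq_bigr => r _; apply: eq_bigr => s _; rewrite eqF eqG.
Qed.

Lemma contract2_pullback_cat k l A h (S : tensor R n (k + 2))
    (T : tensor R n (l + 2)) t t' :
  contract2 h (fun r s => pullback A S (cat_tuple t [tuple r; s]))
              (fun p q => pullback A T (cat_tuple t' [tuple p; q])) =
  pullback A (fun u => pullback A (fun u' => contract2 (A *m h *m A^T)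
    (fun r s => S (cat_tuple u [tuple r; s]))
    (fun p q => T (cat_tuple u' [tuple p; q]))) t') t.
Proof.
rewrite (eq_contract2 h (pullback_slot2 A S t) (pullback_slot2 A T t')).
rewrite contract2_pullback.
rewrite [RHS](eq_pullback A (T' := fun u => \sum_p \sum_q \sum_r \sum_s
  (A *m h *m A^T) r p * ((A *m h *m A^T) s q *
  pullback A (fun u' => S (cat_tuple u [tuple r; s]) *
                        T (cat_tuple u' [tuple p; q])) t'))) => [|u].
  rewrite pullback_sum; apply: eq_bigr => p _.
  rewrite pullback_sum; apply: eq_bigr => q _.
  rewrite pullback_sum; apply: eq_bigr => r _.
  rewrite pullback_sum; apply: eq_bigr => s _.
  rewrite !pullbackZ pullback_mul; ring.
rewrite pullback_sum; apply: eq_bigr => p _.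
rewrite pullback_sum; apply: eq_bigr => q _.
rewrite pullback_sum; apply: eq_bigr => r _.
rewrite pullback_sum; apply: eq_bigr => s _.
rewrite -!pullbackZ; apply: eq_pullback => u'; ring.
Qed.

End Pullback.

Section TorsionPullback.
Variables (R : realType) (A h h0 : 'M[R]_8) (Phi Phi' : tensor R 8 4).
Variables X X' : 'I_8 -> tensor R 8 4.
Hypothesis hE : A *m h *m A^T = h0.
Hypothesis PhiE : Phi' =1 pullback A Phi.
Hypothesis X'E : forall p t, X' p t = \sum_i A i p * pullback A (X i) t.

(** This is used twice: with an adapted frame, where [h0] is the identity and [Phi] the flat form,
    to verify the formula at a point; and with a Jacobian, to make the torsion a tensor field. *)
Lemma torsion3_pullback :
  torsion3 h Phi' X' =1 pullback A (torsion3 h0 Phi X).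
Proof.
move=> t; rewrite -alt_pullback; apply: eq_alt => {}t.
case/tupleP: t => a t; case/tupleP: t => b t; case/tupleP: t => c t.
rewrite (tuple0 t) {t}.
rewrite [RHS]pullbackD pullbackZ -(divergence_pullback hE X'E); congr (_ + _).
rewrite (eq_pullback A (T' := fun u => - 8^-1 * contract2 h0
  (fun r s => divergence h0 X [tuple tnth u 0; r; s])
  (fun p q => Phi [tuple tnth u 1; tnth u 2; p; q]))) => [|u]; last first.
  by rewrite mulNr.
rewrite pullbackZ mulNr; congr (- (_ * _)).
have -> : [tuple of a :: [tuple of b :: [tuple of c :: [tuple]]]] =
    cat_tuple [tuple a] [tuple b; c] by apply: val_inj.
rewrite (pullback_cat (k := 1) (l := 2)).
transitivity (contract2 h
  (fun r s => pullback A (divergence h0 X) (cat_tuple [tuple a] [tuple r; s]))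
  (fun p q => pullback A Phi (cat_tuple [tuple b; c] [tuple p; q]))).
  apply: eq_contract2 => r s; rewrite -?PhiE -?(divergence_pullback hE X'E).
    by congr (divergence _ _ _); apply: val_inj.
  by congr (Phi' _); apply: val_inj.
rewrite (contract2_pullback_cat (k := 1) (l := 2)) hE; apply: eq_pullback => u.
apply: eq_pullback => u'; apply: eq_contract2 => r s.
  by congr (divergence _ _ _); apply: val_inj; case/tupleP: u => ? u;
     rewrite (tuple0 u).
congr (Phi _); apply: val_inj; case/tupleP: u => ? u; rewrite (tuple0 u).
by case/tupleP: u' => ? u'; case/tupleP: u' => ? u'; rewrite (tuple0 u').
Qed.

End TorsionPullback.

(** * Pointwise identities *)

Section Pointwise.
Variables (R : realType).

Lemma tuple4_eta (T : Type) (t : 4.-tuple T) :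
  t = [tuple tnth t 0; tnth t 1; tnth t 2; tnth t 3].
Proof.
by apply: eq_from_tnth => -[[|[|[|[|//]]]] lt_r];
  rewrite [RHS](tnth_nth (tnth t 0)) /=;
  congr (tnth t _); apply: val_inj.
Qed.

Definition double_contraction n (h : 'M[R]_n) (S T : tensor R n 4) :
    tensor R n 4 :=
  fun t => contract2 h (fun r s => S [tuple tnth t 0; tnth t 1; r; s])
                       (fun p q => T [tuple tnth t 2; tnth t 3; p; q]).

Lemma double_contraction_pullback n (A h : 'M[R]_n) (S T : tensor R n 4) :
  double_contraction h (pullback A S) (pullback A T) =1
  pullback A (double_contraction (A *m h *m A^T) S T).
Proof.
move=> t; rewrite [t]tuple4_eta.
move: (tnth t 0) (tnth t 1) (tnth t 2) (tnth t 3) => i j k l {t}.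
have -> : [tuple i; j; k; l] = cat_tuple [tuple i; j] [tuple k; l].
  exact: val_inj.
rewrite (pullback_cat (k := 2) (l := 2)).
transitivity (contract2 h
  (fun r s => pullback A S (cat_tuple [tuple i; j] [tuple r; s]))
  (fun p q => pullback A T (cat_tuple [tuple k; l] [tuple p; q]))).
  by apply: eq_contract2 => r s; congr pullback; apply: val_inj.
rewrite (contract2_pullback_cat (k := 2) (l := 2)); apply: eq_pullback => u.
apply: eq_pullback => u'; case/tupleP: u => a u; case/tupleP: u => b u.
case/tupleP: u' => c u'; case/tupleP: u' => d u'.
rewrite (tuple0 u) (tuple0 u').
by apply: eq_contract2 => r s; [congr S|congr T]; apply: val_inj.
Qed.

Definition pair_swap : 'S_4 := (tperm 0%R 2%R * tperm 1%R 3%R)%g.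

Lemma permute_pair_swap n (i j k l : 'I_n) :
  permute pair_swap [tuple i; j; k; l] = [tuple k; l; i; j].
Proof.
apply: eq_from_tnth => r; rewrite tnth_mktuple permM.
have [->|[->|[->|->]]] : r = 0 \/ r = 1 \/ r = 2 \/ r = 3.
- by case: r => -[|[|[|[|//]]]] lt_r; [left|right; left|right; right; left|
    right; right; right]; apply: val_inj.
- by rewrite tpermL tpermD.
- by rewrite [tperm 0 2 1]tpermD // tpermL.
- by rewrite tpermR tpermD.
- by rewrite [tperm 0 2 3]tpermD // tpermR.
Qed.

(* [Phi_ij^pq w_klpq + Phi_kl^pq w_ijpq = -4 w_ijkl], the linearisation of
   [Phi_ij^pq Phi_klpq = 6 g_ik g_jl - 6 g_il g_jk - 4 Phi_ijkl] *)
Definition infinitesimal n (h : 'M[R]_n) (Phi w : tensor R n 4) : Prop :=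
  forall t, double_contraction h Phi w t
            + double_contraction h Phi w (permute pair_swap t) = - 4 * w t.

Lemma infinitesimal_pullback n (A h : 'M[R]_n) (Phi w : tensor R n 4) :
  infinitesimal (A *m h *m A^T) Phi w ->
  infinitesimal h (pullback A Phi) (pullback A w).
Proof.
move=> inf_w t; rewrite !double_contraction_pullback pullback_permute.
by rewrite -pullbackD -pullbackZ; apply: eq_pullback.
Qed.

Lemma eq_infinitesimal n (h : 'M[R]_n) (Phi Phi' w w' : tensor R n 4) :
  Phi =1 Phi' -> w =1 w' -> infinitesimal h Phi w -> infinitesimal h Phi' w'.
Proof.
move=> eqPhi eqw inf_w t; rewrite -eqw -inf_w.
by congr (_ + _); apply: eq_contract2 => r s; rewrite ?eqPhi ?eqw.
Qed.

(** Exchanging the two index pairs is an even permutation, so both contractions have the same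
    alternation [alt Q]. Hence [2 alt Q = - 4 w], and [J4] is [3 alt Q]. *)
Lemma infinitesimal_J4 (g : tensor R 8 2) (Phi w : tensor R 8 4) :
  alternating w -> infinitesimal (invmx (mx_of_tensor g)) Phi w ->
  forall t, J4 g Phi w t = - 6 * w t.
Proof.
move=> altw inf_w t; set h := invmx _ in inf_w.
have -> : J4 g Phi w t = 3 * alt (double_contraction h Phi w) t by [].
move: inf_w; rewrite /infinitesimal.
move: (double_contraction h Phi w) => Q inf_w.
have even_swap : odd_perm pair_swap = false by rewrite odd_permM !odd_tperm.
have := eq_alt inf_w t; rewrite altD altZ (alt_alternating altw) alt_permute.
rewrite even_swap mul1r; move: (alt Q t) (w t) => x y E1; lra.
Qed.

Definition action_term n (h : 'M[R]_n) (Phi : tensor R n 4) (T : tensor R n 3)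
    (i : 'I_n) : tensor R n 4 :=
  fun u => \sum_p \sum_q T [tuple i; tnth u 0; q] * h q p *
                         Phi [tuple p; tnth u 1; tnth u 2; tnth u 3].

Lemma action_term_pullback n (A h : 'M[R]_n) (Phi : tensor R n 4)
    (T : tensor R n 3) i t :
  action_term h (pullback A Phi) (pullback A T) i t =
  \sum_m A m i * pullback A (action_term (A *m h *m A^T) Phi T m) t.
Proof.
rewrite [t]tuple4_eta.
move: (tnth t 0) (tnth t 1) (tnth t 2) (tnth t 3) => a b c d {t}.
transitivity (\sum_p \sum_q pullback A T (cat_tuple [tuple i; a] [tuple q]) *
    h q p * pullback A Phi (cons_tuple p [tuple b; c; d])).
  apply: eq_bigr => p _; apply: eq_bigr => q _.
  by congr (pullback A T _ * _ * pullback A Phi _); apply: val_inj.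
rewrite (contract1_pullback (k := 2)).
rewrite (pullback_cons (k := 1)); apply: eq_bigr => m _; congr (_ * _).
have -> : [tuple a; b; c; d] = cat_tuple [tuple a] [tuple b; c; d].
  exact: val_inj.
rewrite (pullback_cat (k := 1) (l := 3)); apply: eq_pullback => u.
apply: eq_pullback => u'; case/tupleP: u => a' u; rewrite (tuple0 u) {u}.
case/tupleP: u' => b' u'; case/tupleP: u' => c' u'; case/tupleP: u' => d' u'.
rewrite (tuple0 u'); apply: eq_bigr => p _; apply: eq_bigr => q _.
by congr (T _ * _ * Phi _); apply: val_inj.
Qed.

Lemma flat_infinitesimal (w : 'I_8 -> tensor R 8 4) :
  (forall i, alternating (w i)) ->
  (forall i, infinitesimal 1%:M (cayley0 R) (w i)) ->
  forall i t, w i t = 4 * alt (action_term 1%:M (cayley0 R)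
    (torsion3 1%:M (cayley0 R) w) i) t.
Proof.
move=> altw inf_w i t; set K := action_term _ _ _ i.
(* The identity and the three transpositions move each index in turn to the first slot. Each signed
   term has alternation [alt K], so alternating both sides gives [w = 4 alt K]. *)
have wE u : w i u = K u - K (permute (tperm 0 1) u) - K (permute (tperm 0 2) u)
    - K (permute (tperm 0 3) u).
  have KE v : K v = \sum_p torsion3 1%:M (cayley0 R) w [tuple i; tnth v 0; p] *
      cayley0 R [tuple p; tnth v 1; tnth v 2; tnth v 3].
    by apply: eq_bigr => p _; rewrite -mulr_suml sum_delta_r.
  rewrite !KE !tnth_mktuple !(tpermL, tpermR) ![tperm _ _ _]tpermD //.
  rewrite {1}[u]tuple4_eta; apply: flat_torsion => // j a b c d.
  have := inf_w j [tuple a; b; c; d].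
  by rewrite permute_pair_swap /double_contraction !contract2_1.
rewrite -(alt_alternating (altw i) t) (eq_alt wE) !altB !alt_permute.
by rewrite !odd_tperm /= !expr1; ring.
Qed.

End Pointwise.

(** * Transfer from the flat model through an adapted frame *)

Section Frame.
Variables (R : realType).

Lemma mx_of_pullback n (A : 'M[R]_n) (T : tensor R n 2) :
  mx_of_tensor (pullback A T) = A^T *m mx_of_tensor T *m A.
Proof.
apply/matrixP => i j; rewrite !mxE pullback_cons.
under [RHS]eq_bigr => l _ do rewrite mxE mulr_suml.
rewrite exchange_big; apply: eq_bigr => k _ /=; rewrite pullback_cons mulr_sumr.
apply: eq_bigr => l _; rewrite pullback_nil !mxE mulrCA mulrC.
by congr (_ * _ * _).
Qed.

Lemma mx_of_kronecker n : mx_of_tensor (@kronecker R n) = 1%:M.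
Proof. by apply/matrixP => i j; rewrite !mxE. Qed.

Lemma frame_invmx n (A : 'M[R]_n) : A \in unitmx ->
  A *m invmx (A^T *m A) *m A^T = 1%:M.
Proof.
move=> uA; apply: mulmx1C; rewrite mulmxA mulmxV // unitmx_mul unitmx_tr.
by rewrite uA.
Qed.

(** As a 4-tensor, the product of two metrics gives both metric terms of the quadratic identity by
    permuting indices, and the whole identity can be pulled back at once. *)
Definition kronecker2 n : tensor R n 4 := fun t =>
  kronecker R [tuple tnth t 0; tnth t 1] *
  kronecker R [tuple tnth t 2; tnth t 3].

Lemma pullback_kronecker2 n (A : 'M[R]_n) i j k l :
  pullback A (@kronecker2 n) [tuple i; j; k; l] =
  pullback A (@kronecker R n) [tuple i; j] *
  pullback A (@kronecker R n) [tuple k; l].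
Proof.
have -> : [tuple i; j; k; l] = cat_tuple [tuple i; j] [tuple k; l].
  exact: val_inj.
rewrite (pullback_cat (k := 2) (l := 2)) -pullback_mul.
apply: eq_pullback => u; apply: eq_pullback => u'.
case/tupleP: u => a u; case/tupleP: u => b u; rewrite (tuple0 u).
case/tupleP: u' => c u'; case/tupleP: u' => d u'; rewrite (tuple0 u').
by congr (kronecker R _ * kronecker R _); apply: val_inj.
Qed.

Lemma permute_tperm12 n (i j k l : 'I_n) :
  permute (tperm 1 2) [tuple i; j; k; l] = [tuple i; k; j; l].
Proof.
apply: eq_from_tnth => r; rewrite tnth_mktuple.
case: tpermP => [->|->|/eqP r1 /eqP r2] //.
by case: r r1 r2 => -[|[|[|[|//]]]].
Qed.

Lemma permute_tperm23 n (i j k l : 'I_n) :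
  permute (tperm 2 3) [tuple i; j; k; l] = [tuple i; j; l; k].
Proof.
apply: eq_from_tnth => r; rewrite tnth_mktuple.
case: tpermP => [->|->|/eqP r1 /eqP r2] //.
by case: r r1 r2 => -[|[|[|[|//]]]].
Qed.

(** Differences are written as sums with scalar factors so that [pullbackD] and [pullbackZ]
    apply. *)
Lemma flat_quadratic t :
  double_contraction 1%:M (cayley0 R) (cayley0 R) t =
  6 * (kronecker2 (permute (tperm 1 2) t)
       + -1 * kronecker2 (permute (tperm 1 2) (permute (tperm 2 3) t)))
  + - 4 * cayley0 R t.
Proof.
rewrite {1}/double_contraction contract2_1 cayley0_cayley0 -tuple4_eta.
rewrite [t in RHS]tuple4_eta permute_tperm23 !permute_tperm12.
rewrite /kronecker2 /kronecker -!tuple4_eta /=; ring.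
Qed.

Variables (g : tensor R 8 2) (Phi : tensor R 8 4) (A : 'M[R]_8).
Hypotheses (uA : A \in unitmx) (PhiE : Phi =1 pullback A (cayley0 R))
  (gE : g =1 pullback A (@kronecker R 8)).

Local Notation h := (invmx (mx_of_tensor g)).

Lemma mx_of_metric : mx_of_tensor g = A^T *m A.
Proof.
have -> : mx_of_tensor g = mx_of_tensor (pullback A (@kronecker R 8)).
  by apply/matrixP => i j; rewrite !mxE gE.
by rewrite mx_of_pullback mx_of_kronecker mulmx1.
Qed.

Lemma frame_metric : A *m h *m A^T = 1%:M.
Proof. by rewrite mx_of_metric frame_invmx. Qed.

Lemma quadratic_identity i j k l :
  double_contraction h Phi Phi [tuple i; j; k; l] =
  6 * (g [tuple i; k] * g [tuple j; l] - g [tuple i; l] * g [tuple j; k])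
  - 4 * Phi [tuple i; j; k; l].
Proof.
transitivity (double_contraction h (pullback A (cayley0 R))
    (pullback A (cayley0 R)) [tuple i; j; k; l]).
  by apply: eq_contract2 => r s.
rewrite double_contraction_pullback frame_metric (eq_pullback A flat_quadratic).
rewrite pullbackD !pullbackZ pullbackD pullbackZ -!pullback_permute.
rewrite -(pullback_permute A (fun t => kronecker2 (permute (tperm 1 2) t))).
rewrite -pullback_permute permute_tperm23 !permute_tperm12 !pullback_kronecker2.
by rewrite -!gE PhiE; ring.
Qed.

(** The family [X] is carried to the orthonormal frame by the inverse [B] of [A], the flat identity
    is applied there, and the result is pulled back by [A]. *)
Lemma torsion3_action (X : 'I_8 -> tensor R 8 4) :
  (forall i, alternating (X i)) -> (forall i, infinitesimal h Phi (X i)) ->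
  forall i t, X i t = 4 * torsion_action g Phi (torsion3 h Phi X) i t.
Proof.
move=> altX inf_X i t; pose B := invmx A.
have hE : h = B *m 1%:M *m B^T.
  have := frame_metric => /(congr1 (fun C => B *m C *m B^T)) <-.
  rewrite /B -!mulmxA -trmx_mul mulVmx // trmx1 mulmx1 mulmxA.
  by rewrite mulVmx // mul1mx.
have PhiB : cayley0 R =1 pullback B Phi.
  move=> u; rewrite (eq_pullback B PhiE) pullbackM mulmxV ?pullback1 //.
(* The derivative index is a tensor index as well and transforms along with the other four. *)
pose w m := fun u => \sum_j B j m * pullback B (X j) u.
have inf_w m : infinitesimal 1%:M (cayley0 R) (w m).
  have inf_B j : infinitesimal 1%:M (cayley0 R) (pullback B (X j)).
    apply: (eq_infinitesimal (Phi := pullback B Phi)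
      (w := pullback B (X j))) => //.
    by apply: infinitesimal_pullback; rewrite -hE.
  move=> u; have dcE v : double_contraction 1%:M (cayley0 R) (w m) v =
      \sum_j B j m * double_contraction 1%:M (cayley0 R) (pullback B (X j)) v.
    rewrite /double_contraction contract2_1.
    under [RHS]eq_bigr => j _ do rewrite contract2_1 mulr_sumr.
    rewrite [RHS]exchange_big; apply: eq_bigr => p _ /=.
    under [RHS]eq_bigr => j _ do rewrite mulr_sumr.
    rewrite [RHS]exchange_big; apply: eq_bigr => q _ /=; rewrite mulr_sumr.
    by apply: eq_bigr => j _; rewrite mulrCA.
  rewrite !dcE -big_split /w mulr_sumr; apply: eq_bigr => j _ /=.
  by rewrite -mulrDr inf_B mulrCA.
have altw m : alternating (w m).
  move=> s u; rewrite mulr_sumr; apply: eq_bigr => j _.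
  by rewrite (alternating_pullback B (altX j)) mulrCA.
have XE p u : X p u = \sum_m A m p * pullback A (w m) u.
  under eq_bigr => m _.
    rewrite /w pullback_sum mulr_sumr.
    under eq_bigr => j _ do
      rewrite pullbackZ pullbackM mulVmx // pullback1 mulrA.
    over.
  rewrite exchange_big /= (bigD1 p) //= -mulr_suml.
  have BA j : \sum_m A m p * B j m = (1%:M : 'M[R]_8) j p.
    by rewrite -(mulVmx uA) mxE; apply: eq_bigr => m _; rewrite mulrC.
  rewrite BA mxE eqxx mul1r big1 ?addr0 // => j /negbTE neq_j.
  by rewrite -mulr_suml BA mxE neq_j mul0r.
have TE : torsion3 h Phi X =1 pullback A (torsion3 1%:M (cayley0 R) w).
  exact: torsion3_pullback frame_metric PhiE XE.
have actE u : action_term h Phi (torsion3 h Phi X) i u =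
    \sum_m A m i * pullback A (action_term 1%:M (cayley0 R)
                                 (torsion3 1%:M (cayley0 R) w) m) u.
  have := action_term_pullback A h (cayley0 R)
    (torsion3 1%:M (cayley0 R) w) i u.
  rewrite frame_metric => <-; apply: eq_bigr => p _.
  by apply: eq_bigr => q _; rewrite TE PhiE.
have -> : torsion_action g Phi (torsion3 h Phi X) i t =
    alt (action_term h Phi (torsion3 h Phi X) i) t by [].
rewrite (eq_alt actE) XE.
have -> : alt (fun u => \sum_m A m i * pullback A (action_term 1%:M (cayley0 R)
    (torsion3 1%:M (cayley0 R) w) m) u) t = \sum_m A m i * alt (pullback A
    (action_term 1%:M (cayley0 R) (torsion3 1%:M (cayley0 R) w) m)) t.
  rewrite /alt; under eq_bigr => s _ do rewrite mulr_sumr.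
  rewrite exchange_big mulr_sumr; apply: eq_bigr => m _ /=.
  rewrite mulrCA; congr (_ * _); rewrite mulr_sumr.
  by apply: eq_bigr => s _; rewrite mulrCA.
rewrite mulr_sumr; apply: eq_bigr => m _; rewrite mulrCA; congr (_ * _).
rewrite alt_pullback -pullbackZ; apply: eq_pullback => u.
exact: flat_infinitesimal.
Qed.

End Frame.

(** * Smooth functions *)

Lemma near_eq_differentiable (R : realType) (V W : normedModType R)
    (f g : V -> W) (x : V) :
  (\near x, f x = g x) -> differentiable f x -> differentiable g x.
Proof.
move=> fg df; have -> : g = f + (g - f) by rewrite addrC subrK.
apply: differentiableD => //.
have r0 : \forall y \near x, (g - f) y = 0.
  apply: filterS fg => y fy; rewrite -[LHS]/(g y - f y) fy; exact: subrr.
move: (g - f) r0 => r r0 {df fg f g}.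
(* The differential is obtained by choice, so it suffices to exhibit one admissible linear map; as
   [r] vanishes near [x], the zero map is one. *)
apply/diffP; apply: (@getPex _ (fun df : {linear V -> W} => continuous df /\
  forall y, r y = r (lim (nbhs x)) + df (y - lim (nbhs x))
                  +o_(y \near x) (y - lim (nbhs x)))).
pose z : {linear V -> W} := \0.
exists z; split; first exact: cst_continuous.
have : r = cst (r (lim (nbhs x))) +o_x (center (lim (nbhs x))).
  apply/eqaddoP => e e0; near=> y.
  rewrite -[X in `|X|]/(r y - r (lim (nbhs x))) lim_id //.
  have -> : r y = 0 by near: y.
  by rewrite (nbhs_singleton r0) subrr normr0 mulr_ge0 // ltW.
by move=> rE y; rewrite [LHS](congr1 (@^~ y) rE) /= addr0.
Unshelve. all: by end_near.
Qed.

Lemma near_cvg_eq (V W : topologicalType) (f g : V -> W) (x : V) (l : W) :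
  (\near x, f x = g x) -> f @ x --> l -> g @ x --> l.
Proof.
by move=> fg fl; apply: cvg_trans fl; apply: near_eq_cvg.
Qed.

Section SmoothFunctions.
Variables (R : realType) (n : nat) (U : set 'rV[R]_n).
Hypothesis openU : open U.
Implicit Types f g : 'rV[R]_n -> R.

Lemma near_open (P : 'rV[R]_n -> Prop) x :
  U x -> (forall y, U y -> P y) -> \near x, P x.
Proof.
by move=> Ux UP; apply: filterS UP _; apply: open_nbhs_nbhs; split.
Qed.

(** Since [U] is open, derivatives at its points depend only on values in [U]. This is what makes
    the values of components outside a chart irrelevant. *)
Lemma Ck_ext k f g : (forall x, U x -> f x = g x) -> Ck k U f -> Ck k U g.
Proof.
elim: k f g => [|k IHk] f g fg /=.
  move=> cf x Ux; rewrite /prop_for /continuous_at -fg //.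
  by apply: near_cvg_eq (cf x Ux); apply: near_open Ux fg.
move=> [df pf]; split=> [x Ux|i].
  by apply: near_eq_differentiable (df x Ux); exact: near_open Ux fg.
apply: IHk (pf i) => x Ux; by apply: near_eq_derive; exact: near_open Ux fg.
Qed.

Lemma CkW k f : Ck k.+1 U f -> Ck k U f.
Proof.
elim: k f => [|k IHk] f [df pf].
  by move=> x Ux; apply: differentiable_continuous; apply: df.
by split=> // i; apply: IHk.
Qed.

Lemma Ck_cst k c : Ck k U (fun=> c).
Proof.
elim: k c => [|k IHk] c /=; first by move=> x _; apply: cst_continuous.
split=> [x _|i]; first exact: differentiable_cst.
apply: Ck_ext (IHk 0) => x _; apply/esym; exact: derive_cst.
Qed.

Lemma CkD k f g : Ck k U f -> Ck k U g -> Ck k U (fun x => f x + g x).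
Proof.
elim: k f g => [|k IHk] f g /=.
  by move=> cf cg x Ux; exact: cvgD (cf x Ux) (cg x Ux).
move=> [df pf] [dg pg]; split=> [x Ux|i].
  by apply: differentiableD; [apply: df|apply: dg].
apply: Ck_ext (IHk _ _ (pf i) (pg i)) => x Ux; apply/esym/deriveD.
  exact/diff_derivable/df.
exact/diff_derivable/dg.
Qed.

Lemma CkM k f g : Ck k U f -> Ck k U g -> Ck k U (fun x => f x * g x).
Proof.
elim: k f g => [|k IHk] f g.
  by move=> cf cg x Ux; exact: cvgM (cf x Ux) (cg x Ux).
move=> Cf Cg; have [[df pf] [dg pg]] := (Cf, Cg); split=> [x Ux|i].
  by apply: differentiableM; [apply: df|apply: dg].
apply: Ck_ext (CkD (IHk _ _ (CkW Cf) (pg i)) (IHk _ _ (CkW Cg) (pf i))) => x Ux.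
apply/esym/deriveM; first exact/diff_derivable/df.
exact/diff_derivable/dg.
Qed.

Lemma CkV k f : (forall x, U x -> f x != 0) -> Ck k U f ->
  Ck k U (fun x => (f x)^-1).
Proof.
move=> f0; elim: k => [|k IHk].
  by move=> cf x Ux; exact: cvgV (f0 x Ux) (cf x Ux).
move=> Cf; have [df pf] := Cf; split=> [x Ux|i].
  by apply: differentiableV; [apply: df|apply: f0].
have CfV := IHk (CkW Cf).
apply: Ck_ext (CkM (CkM (Ck_cst k (-1)) (CkM CfV CfV)) (pf i)) => x Ux.
rewrite /partial deriveV ?f0 //; last exact/diff_derivable/df.
by rewrite mulN1r -invfM -expr2 exprnN.
Qed.

Lemma smooth_on_ext f g : (forall x, U x -> f x = g x) ->
  smooth_on U f -> smooth_on U g.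
Proof. by move=> fg Sf k; apply: Ck_ext (Sf k). Qed.

Lemma smooth_on_cst c : smooth_on U (fun=> c).
Proof. by move=> k; apply: Ck_cst. Qed.

Lemma smooth_onD f g : smooth_on U f -> smooth_on U g ->
  smooth_on U (fun x => f x + g x).
Proof. by move=> Sf Sg k; apply: CkD. Qed.

Lemma smooth_onM f g : smooth_on U f -> smooth_on U g ->
  smooth_on U (fun x => f x * g x).
Proof. by move=> Sf Sg k; apply: CkM. Qed.

Lemma smooth_onV f : (forall x, U x -> f x != 0) -> smooth_on U f ->
  smooth_on U (fun x => (f x)^-1).
Proof. by move=> f0 Sf k; apply: CkV. Qed.

Lemma smooth_on_sum (I : Type) (r : seq I) (P : pred I)
    (F : I -> 'rV[R]_n -> R) : (forall i, P i -> smooth_on U (F i)) ->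
  smooth_on U (fun x => \sum_(i <- r | P i) F i x).
Proof.
move=> SF; elim: r => [|i r IHr].
  apply: smooth_on_ext (smooth_on_cst 0) => x _; by rewrite big_nil.
case Pi: (P i); last first.
  by apply: smooth_on_ext IHr => x _; rewrite big_cons Pi.
apply: smooth_on_ext (smooth_onD (SF i Pi) IHr) => x _.
by rewrite big_cons Pi.
Qed.

Lemma smooth_on_prod (I : Type) (r : seq I) (P : pred I)
    (F : I -> 'rV[R]_n -> R) : (forall i, P i -> smooth_on U (F i)) ->
  smooth_on U (fun x => \prod_(i <- r | P i) F i x).
Proof.
move=> SF; elim: r => [|i r IHr].
  apply: smooth_on_ext (smooth_on_cst 1) => x _; by rewrite big_nil.
case Pi: (P i); last first.
  by apply: smooth_on_ext IHr => x _; rewrite big_cons Pi.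
apply: smooth_on_ext (smooth_onM (SF i Pi) IHr) => x _.
by rewrite big_cons Pi.
Qed.

Lemma smooth_on_partial i f : smooth_on U f -> smooth_on U (partial i f).
Proof. by move=> Sf k; case: (Sf k.+1) => _; apply. Qed.

Lemma smooth_on_differentiable f x : smooth_on U f -> U x -> differentiable f x.
Proof. by move=> Sf; have [df _] := Sf 1%N; apply: df. Qed.

Lemma smooth_on_det m (A : 'rV[R]_n -> 'M[R]_m) :
  (forall i j, smooth_on U (fun x => A x i j)) ->
  smooth_on U (fun x => \det (A x)).
Proof.
move=> SA; apply: (@smooth_on_ext (fun x =>
  \sum_(s : 'S_m) (-1) ^+ s * \prod_i A x i (s i))) => //.
apply: smooth_on_sum => s _; apply: smooth_onM.
  exact: smooth_on_cst.
by apply: smooth_on_prod => i _; apply: SA.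
Qed.

Lemma smooth_on_invmx m (A : 'rV[R]_n -> 'M[R]_m) :
  (forall x, U x -> A x \in unitmx) ->
  (forall i j, smooth_on U (fun x => A x i j)) ->
  forall i j, smooth_on U (fun x => invmx (A x) i j).
Proof.
move=> uA SA i j.
apply: (@smooth_on_ext (fun x => (\det (A x))^-1 * ((-1) ^+ (j + i) *
    \det (row' j (col' i (A x)))))) => [x Ux|].
  by rewrite /invmx uA // !mxE.
apply: smooth_onM.
  apply: smooth_onV; last exact: smooth_on_det.
  by move=> x Ux; rewrite -unitfE; apply: uA.
apply: smooth_onM; first exact: smooth_on_cst.
apply: smooth_on_det => k l.
by apply: smooth_on_ext (SA (lift j k) (lift i l)) => x _; rewrite !mxE.
Qed.

End SmoothFunctions.

(** * Derivatives of pullbacks *)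

Section DeriveBig.
Variables (R : realType) (V : normedModType R).
Implicit Types (x v : V).

Lemma is_derive_bigsum (I : finType) x v (F : I -> V -> R) (dF : I -> R) :
  (forall i, is_derive x v (F i) (dF i)) ->
  is_derive x v (fun y => \sum_i F i y) (\sum_i dF i).
Proof.
move=> dFi; have -> : (fun y => \sum_i F i y) = \sum_i F i.
  by apply/funext => y; rewrite fct_sumE.
elim/big_ind2 : _ => // [|f df g dg Hf Hg]; first exact: is_derive_cst.
exact: is_deriveD.
Qed.

Lemma is_derive_mul x v (f g : V -> R) df dg :
  is_derive x v f df -> is_derive x v g dg ->
  is_derive x v (fun y => f y * g y) (df * g x + f x * dg).
Proof.
move=> Hf Hg; apply: is_derive_eq (is_deriveM Hf Hg) _.
by rewrite addrC [df * _]mulrC.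
Qed.

Lemma is_derive_prod k x v (F : 'I_k -> V -> R) (dF : 'I_k -> R) :
  (forall i, is_derive x v (F i) (dF i)) ->
  is_derive x v (fun y => \prod_i F i y)
                (\sum_s dF s * \prod_(r | r != s) F r x).
Proof.
elim: k F dF => [|k IHk] F dF dFi.
  have -> : (fun y => \prod_i F i y) = cst 1.
    by apply/funext => y; rewrite big_ord0.
  rewrite big_ord0; exact: is_derive_cst.
have -> : (fun y => \prod_i F i y) =
    (fun y => F ord0 y * \prod_i F (lift ord0 i) y).
  by apply/funext => y; rewrite big_ord_recl.
have dFl := IHk _ _ (fun i => dFi (lift ord0 i)).
apply: is_derive_eq (is_derive_mul (dFi ord0) dFl) _.
rewrite big_ord_recl; congr (_ + _).
  congr (_ * _); rewrite [RHS]big_mkcond [RHS]big_ord_recl eqxx /= mul1r.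
  exact: eq_bigr.
rewrite mulr_sumr; apply: eq_bigr => s _; rewrite mulrCA; congr (_ * _).
rewrite [RHS]big_mkcond [RHS]big_ord_recl /=.
congr (_ * _); rewrite big_mkcond; apply: eq_bigr => r _.
by rewrite (inj_eq lift_inj).
Qed.

End DeriveBig.

Section SlotPullback.
Variables (R : realType) (n k : nat).
Implicit Types (A B G : 'M[R]_n) (T : tensor R n k) (t : k.-tuple 'I_n).

(** The Leibniz term of a pullback in which the factor of slot [s] has been differentiated: there
    [A] is replaced by [B], its derivative in the applications. *)
Definition slot_pullback (s : 'I_k) A B T : tensor R n k :=
  fun t => \sum_u B (tnth u s) (tnth t s) *
                  (\prod_(r | r != s) A (tnth u r) (tnth t r)) * T u.

Definition slot_action (s : 'I_k) G T : tensor R n k :=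
  fun t => \sum_q G q (tnth t s) * T (replace t s q).

Lemma tnth_replace t s q r :
  tnth (replace t s q) r = if r == s then q else tnth t r.
Proof. by rewrite tnth_mktuple. Qed.

Lemma slot_pullbackMr s A G T t :
  slot_pullback s A (A *m G) T t = slot_action s G (pullback A T) t.
Proof.
rewrite /slot_pullback /slot_action.
under eq_bigr => u _ do rewrite mxE mulr_suml mulr_suml.
rewrite exchange_big; apply: eq_bigr => q _ /=; rewrite mulr_sumr.
apply: eq_bigr => u _; rewrite [in RHS](bigD1 s) //= tnth_replace eqxx.
rewrite [A _ _ * G _ _]mulrC -!mulrA; congr (_ * (_ * (_ * _))).
by apply: eq_bigr => r /negbTE rs; rewrite tnth_replace rs.
Qed.

Lemma slot_pullbackMl s A G T t :
  slot_pullback s A (G *m A) T t = pullback A (slot_action s G T) t.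
Proof.
pose F u l := G (tnth u s) l * A l (tnth t s) *
  (\prod_(r | r != s) A (tnth u r) (tnth t r)) * T u.
transitivity (\sum_(p : k.-tuple 'I_n * 'I_n) F p.1 p.2).
  rewrite -(pair_bigA _ F) /=; apply: eq_bigr => u _.
  by rewrite mxE !mulr_suml.
(* Both sides sum over a tuple and one further index; they are matched by exchanging that index with
   the entry in slot [s]. *)
pose sw (p : k.-tuple 'I_n * 'I_n) := (replace p.1 s p.2, tnth p.1 s).
have swK : involutive sw.
  move=> [u q]; rewrite /sw /= tnth_replace eqxx; congr (_, _).
  apply: eq_from_tnth => r; rewrite !tnth_replace.
  by case: eqP => // ->.
rewrite (reindex_inj (inv_inj swK)).
rewrite -(pair_bigA _ (fun u q => F (sw (u, q)).1 (sw (u, q)).2)).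
apply: eq_bigr => u _ /=; rewrite /slot_action mulr_sumr.
apply: eq_bigr => q _; rewrite /F /= tnth_replace eqxx [in RHS](bigD1 s) //=.
rewrite [in RHS]mulrCA mulrA -!mulrA; congr (_ * (_ * (_ * _))).
by apply: eq_bigr => r /negbTE rs; rewrite tnth_replace rs.
Qed.

Lemma slot_pullbackD s A B B' T t :
  slot_pullback s A (B + B') T t =
  slot_pullback s A B T t + slot_pullback s A B' T t.
Proof.
rewrite -big_split; apply: eq_bigr => u _ /=; rewrite mxE; ring.
Qed.

Lemma is_derive_pullback (V : normedModType R) (x v : V) (A : V -> 'M[R]_n)
    (dA : 'M[R]_n) (T : V -> tensor R n k) (dT : tensor R n k) t :
  (forall i j, is_derive x v (fun y => A y i j) (dA i j)) ->
  (forall u, is_derive x v (fun y => T y u) (dT u)) ->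
  is_derive x v (fun y => pullback (A y) (T y) t)
    (pullback (A x) dT t + \sum_s slot_pullback s (A x) dA (T x) t).
Proof.
move=> HA HT; apply: is_derive_eq.
  apply: is_derive_bigsum => u; apply: is_derive_mul (HT u).
  by apply: is_derive_prod => s; apply: HA.
rewrite big_split /= addrC; congr (_ + _); rewrite /slot_pullback exchange_big.
by apply: eq_bigr => u _; rewrite mulr_suml.
Qed.

End SlotPullback.

(** * Changes of charts *)

Section ChartChange.
Variables (R : realType) (n : nat) (M : manifold R n).
Local Notation index := (chart_index M).
Local Notation U c := (dom (atlas M c)).
Local Notation x_ c := (coord (atlas M c)).
Local Notation x_inv c := (param (atlas M c)).

(** Turns a neighbourhood in coordinate space into points of the manifold, where the identities for
    components are stated. *)
Lemma near_chart (c : index) (W : set M) p : U c p -> open W -> W p ->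
  \forall y \near x_ c p, exists q, [/\ U c q, W q & y = x_ c q].
Proof.
move=> Up oW Wp.
have cp : (x_ c @` U c) (x_ c p) by exists p.
have nW : \forall y \near x_ c p, W (x_inv c y).
  have := param_continuous cp; apply; rewrite coordK //.
  by apply: open_nbhs_nbhs; split.
have nU : \forall y \near x_ c p, (x_ c @` U c) y.
  by apply: open_nbhs_nbhs; split => //; apply: codom_open.
by apply: filterS2 nU nW => y [q Uq <-]; rewrite coordK // => Wq; exists q.
Qed.

Lemma partial_at_ext (c : index) (W : set M) (f g : M -> R) p i :
  U c p -> open W -> W p -> (forall q, U c q -> W q -> f q = g q) ->
  partial_at c i f p = partial_at c i g p.
Proof.
move=> Up oW Wp fg; apply: near_eq_derive.
apply: filterS (near_chart Up oW Wp) => y [q [Uq Wq ->]].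
by rewrite coordK //; apply: fg.
Qed.

Lemma smooth_in_differentiable (c : index) (f : M -> R) p :
  smooth_in c f -> U c p -> differentiable (fun x => f (x_inv c x)) (x_ c p).
Proof. by move=> Sf Up; apply: smooth_on_differentiable Sf _; exists p. Qed.

Lemma differentiable_transition (c d : index) p k : U c p -> U d p ->
  differentiable (fun x => x_ c (x_inv d x) 0 k) (x_ d p).
Proof.
move=> Uc Ud; apply: smooth_on_differentiable (atlas_smooth d c k) _.
by exists p.
Qed.

Lemma differentiable_jacobian (c d : index) p r j : U c p -> U d p ->
  differentiable (fun x => jacobian c d (x_inv d x) r j) (x_ d p).
Proof.
move=> Uc Ud.
have := smooth_on_partial j (atlas_smooth d c r).
move=> /smooth_on_differentiable-/(_ (x_ d p)) dJ.
apply: near_eq_differentiable (dJ _); last by exists p.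
apply: filterS (near_chart Ud (dom_open (atlas M c)) Uc) => y [q [Uq _ ->]].
by rewrite coordK // mxE.
Qed.

Lemma chain_rule (c d : index) (f : M -> R) p i : U c p -> U d p ->
  differentiable (fun x => f (x_inv c x)) (x_ c p) ->
  is_derive (x_ d p) (delta_mx 0 i) (fun x => f (x_inv d x))
    (\sum_m jacobian c d p m i * partial_at c m f p).
Proof.
move=> Uc Ud df; pose F x := f (x_inv c x).
pose tr x : 'rV[R]_n := x_ c (x_inv d x).
have trp : tr (x_ d p) = x_ c p by rewrite /tr coordK.
have dtr : differentiable tr (x_ d p).
  have -> : tr = \sum_k (fun x => tr x 0 k *: delta_mx 0 k).
    by apply/funext => x; rewrite fct_sumE -row_sum_delta.
  apply: differentiable_sum => k; apply: differentiableZl.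
  exact: differentiable_transition.
have dF : differentiable F (tr (x_ d p)) by rewrite trp.
(* The two coordinate expressions agree only over the overlap of the charts, which is enough for the
   derivative at [x_ d p]. *)
have near_eq : \forall x \near x_ d p, (F \o tr) x = f (x_inv d x).
  apply: filterS (near_chart Ud (dom_open (atlas M c)) Uc) => y [q [Uq Ucq ->]].
  by rewrite /F /tr /= [x_inv d _]coordK // coordK.
apply: near_eq_is_derive near_eq _.
have dFtr := differentiable_comp dtr dF.
apply: DeriveDef; first exact: diff_derivable.
rewrite deriveE // diff_comp // /= -(deriveE _ dtr) derive_mx; last first.
  exact: diff_derivable.
rewrite (row_sum_delta (\matrix_(_, _) _)) linear_sum; apply: eq_bigr => m _.
rewrite linearZ /= !mxE; congr (_ * _).
by rewrite -deriveE // trp.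
Qed.

Lemma partial_at_chain (c d : index) (f : M -> R) p i : U c p -> U d p ->
  differentiable (fun x => f (x_inv c x)) (x_ c p) ->
  partial_at d i f p = \sum_m jacobian c d p m i * partial_at c m f p.
Proof. by move=> Uc Ud df; have [_] := chain_rule i Uc Ud df. Qed.

Lemma jacobian_mul (c d : index) p : U c p -> U d p ->
  jacobian d c p *m jacobian c d p = 1%:M.
Proof.
move=> Uc Ud; apply/matrixP => k i; rewrite !mxE.
pose f q := x_ d q 0 k.
transitivity (partial_at d i f p).
  rewrite (partial_at_chain _ Uc Ud (differentiable_transition k Ud Uc)).
  by apply: eq_bigr => m _; rewrite mulrC; congr (_ * _); rewrite mxE.
rewrite /partial_at /partial.
transitivity ('D_(delta_mx 0 i) (fun x : 'rV[R]_n => x 0 k) (x_ d p)).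
  apply: near_eq_derive.
  apply: filterS (near_chart Ud (dom_open (atlas M c)) Uc) => y [q [Uq _ ->]].
  by rewrite /f coordK.
have := derive_mx (@derivable_id R 'rV[R]_n (x_ d p) (delta_mx 0 i)).
rewrite derive_id => /matrixP/(_ 0 k); rewrite !mxE => <-.
by rewrite eqxx eq_sym.
Qed.

End ChartChange.

(** * The covariant derivative *)

Section CovariantDerivative.
Variables (R : realType) (n : nat) (M : manifold R n) (D : connection M).
Local Notation index := (chart_index M).
Local Notation U c := (dom (atlas M c)).
Local Notation x_ c := (coord (atlas M c)).
Local Notation x_inv c := (param (atlas M c)).

Definition christoffel_mx (c : index) (p : M) (i : 'I_n) : 'M[R]_n :=
  \matrix_(q, j) D c p q i j.

Lemma nablaE k (T : tensor_field M k) c p i t :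
  nabla D T c p i t = partial_at c i (fun q => T c q t) p
    - \sum_s slot_action s (christoffel_mx c p i) (T c p) t.
Proof.
congr (_ - _); apply: eq_bigr => s _; apply: eq_bigr => q _.
by rewrite mxE.
Qed.

Lemma slot_action_sum k (s : 'I_k) (a : 'I_n -> R) (G : 'I_n -> 'M[R]_n)
    (T : tensor R n k) t :
  slot_action s (\sum_m a m *: G m) T t = \sum_m a m * slot_action s (G m) T t.
Proof.
rewrite /slot_action; under eq_bigr => q _ do rewrite summxE mulr_suml.
rewrite exchange_big; apply: eq_bigr => m _; rewrite mulr_sumr.
by apply: eq_bigr => q _; rewrite mxE mulrA.
Qed.

(** The transformation law multiplied by the Jacobian [J]. In this shape, [slot_pullbackMr] handles
    the left side, [slot_pullbackMl] the homogeneous term, and the inhomogeneous term is the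
    derivative of [J]. *)
Lemma christoffel_mx_change c d p i : U c p -> U d p ->
  jacobian c d p *m christoffel_mx d p i =
  (\sum_m jacobian c d p m i *: christoffel_mx c p m) *m jacobian c d p
  + \matrix_(r, j) hessian c d p r i j.
Proof.
move=> Uc Ud; set RHS := (X in _ = X).
suff -> : christoffel_mx d p i = jacobian d c p *m RHS.
  by rewrite mulmxA jacobian_mul // mul1mx.
have change k j := christoffel_change D k i j Uc Ud.
rewrite {}/RHS; move: (jacobian c d p) (jacobian d c p) change => J J' change.
apply/matrixP => k j; rewrite !mxE change; apply: eq_bigr => r _.
rewrite !mxE; congr (_ * (_ + _)).
rewrite exchange_big; apply: eq_bigr => l _; rewrite summxE mulr_suml.
by apply: eq_bigr => m _; rewrite !mxE [J m i * _]mulrC.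
Qed.

(** Differentiating the pulled-back components produces, for every slot, a term with the Hessian of
    the transition map; the inhomogeneous term of the Christoffel symbols cancels it. *)
Lemma nabla_change k (T : tensor_field M k) c d p i t : U c p -> U d p ->
  nabla D T d p i t =
  \sum_m jacobian c d p m i * pullback (jacobian c d p) (nabla D T c p m) t.
Proof.
move=> Uc Ud; set J := jacobian c d p; rewrite nablaE.
rewrite (partial_at_ext (W := U c) (g := fun q =>
  pullback (jacobian c d q) (T c q) t)) //; first last.
- by move=> q Udq Ucq; apply: component_change.
- exact: dom_open.
pose dT u := \sum_m J m i * partial_at c m (fun q => T c q u) p.
have [|u|_] := @is_derive_pullback R n k _ (x_ d p) (delta_mx 0 i)
  (fun x => jacobian c d (x_inv d x)) (\matrix_(r, j) hessian c d p r i j)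
  (fun x => T c (x_inv d x)) dT t.
- move=> r j; rewrite mxE; apply/derivableP/diff_derivable.
  exact: differentiable_jacobian.
- apply: (chain_rule i Uc Ud (f := fun q => T c q u)).
  exact: smooth_in_differentiable (component_smooth T c u) Uc.
rewrite /partial_at /partial /= coordK // => ->.
(* The tensorial part of each connection term is separated from the Hessian part that is to
   cancel. *)
have sT s : slot_action s (christoffel_mx d p i) (T d p) t =
    (\sum_m J m i * pullback J (slot_action s (christoffel_mx c p m) (T c p)) t)
    + slot_pullback s J (\matrix_(r, j) hessian c d p r i j) (T c p) t.
  transitivity (slot_action s (christoffel_mx d p i) (pullback J (T c p)) t).
    by apply: eq_bigr => q _; rewrite (component_change T Uc Ud).
  rewrite -slot_pullbackMr christoffel_mx_change // slot_pullbackD.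
  rewrite slot_pullbackMl; congr (_ + _).
  rewrite (eq_pullback _ (slot_action_sum s _ _ _)) pullback_sum.
  by apply: eq_bigr => m _; rewrite pullbackZ.
rewrite (eq_bigr _ (fun s _ => sT s)) big_split /= -/J opprD addrACA subrr.
rewrite addr0 pullback_sum [X in _ - X]exchange_big /= -sumrB.
apply: eq_bigr => m _ /=.
rewrite pullbackZ -mulr_sumr -mulrBr; congr (_ * _).
rewrite (eq_pullback J (nablaE T c p m)) -pullback_sum -mulN1r -pullbackZ.
by rewrite -pullbackD; apply: eq_pullback => u; rewrite mulN1r.
Qed.

(* The frame [y |-> 1 - (y_i - x_i) Gamma_i] is parallel to first order at [x]
   along the [i]-th coordinate, so that the components with respect to it have
   the covariant derivatives as their partial derivatives. *)
Definition parallel_frame (c : index) (p : M) (i : 'I_n) (y : 'rV[R]_n) :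
    'M[R]_n :=
  1%:M - (y 0 i - x_ c p 0 i) *: christoffel_mx c p i.

Lemma parallel_frame_at c p i : parallel_frame c p i (x_ c p) = 1%:M.
Proof. by rewrite /parallel_frame subrr scale0r subr0. Qed.

Lemma is_derive_coord (x : 'rV[R]_n) (i j : 'I_n) :
  is_derive x (delta_mx 0 i) (fun y : 'rV[R]_n => y 0 j) (j == i)%:R.
Proof.
have dc := @differentiable_coord R 1 n x 0 j.
apply: DeriveDef; first exact: diff_derivable.
have := derive_mx (@derivable_id R 'rV[R]_n x (delta_mx 0 i)).
by rewrite derive_id => /matrixP/(_ 0 j); rewrite !mxE => <-.
Qed.

Lemma is_derive_parallel_frame c p i r j :
  is_derive (x_ c p) (delta_mx 0 i) (fun y => parallel_frame c p i y r j)
    (- christoffel_mx c p i r j).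
Proof.
have -> : (fun y => parallel_frame c p i y r j) = (fun y =>
    (1%:M : 'M[R]_n) r j + - (y 0 i + - x_ c p 0 i) * christoffel_mx c p i r j).
  by apply/funext => y; rewrite !mxE mulNr.
have dyx := is_deriveB (is_derive_coord (x_ c p) i i)
  (is_derive_cst (x_ c p 0 i) (x_ c p) (delta_mx 0 i)).
have dG := is_derive_cst (christoffel_mx c p i r j) (x_ c p) (delta_mx 0 i).
have d1 := is_derive_cst ((1%:M : 'M[R]_n) r j) (x_ c p) (delta_mx 0 i).
apply: is_derive_eq (is_deriveD d1 (is_derive_mul (is_deriveN dyx) dG)) _.
by rewrite eqxx subr0 mulr0 addr0 add0r mulN1r.
Qed.

Lemma is_derive_nabla k (T : tensor_field M k) c p i t : U c p ->
  is_derive (x_ c p) (delta_mx 0 i)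
    (fun y => pullback (parallel_frame c p i y) (T c (x_inv c y)) t)
    (nabla D T c p i t).
Proof.
move=> Up; set G := christoffel_mx c p i.
pose dT u := partial_at c i (fun q => T c q u) p.
have dF := @is_derive_pullback R n k _ (x_ c p) (delta_mx 0 i)
  (parallel_frame c p i) (- G) (fun y => T c (x_inv c y)) dT t.
apply: is_derive_eq (dF _ _) _ => [r j|u|].
- rewrite mxE; exact: is_derive_parallel_frame.
- apply/derivableP/diff_derivable.
  exact: smooth_in_differentiable (component_smooth T c u) Up.
rewrite parallel_frame_at coordK // pullback1 nablaE -sumrN; congr (_ + _).
apply: eq_bigr => s _; rewrite -[- G]mul1mx slot_pullbackMr /slot_action -sumrN.
by apply: eq_bigr => q _; rewrite pullback1 mxE mulNr.
Qed.

(** Covariant derivatives are ordinary derivatives of components in a frame parallel to first order.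
    These components alternate near the point, hence so do their derivatives. *)
Lemma alternating_nabla k (T : tensor_field M k) c p i :
  is_form T -> U c p -> alternating (nabla D T c p i).
Proof.
move=> altT Up s t; have [_ <-] := is_derive_nabla T i (permute s t) Up.
have dT := is_derive_nabla T i t Up.
have ds := is_derive_cst ((-1) ^+ s : R) (x_ c p) (delta_mx 0 i).
have dsT := is_derive_mul ds dT.
have [_ E] := dsT; rewrite mul0r add0r in E; rewrite -E.
apply: near_eq_derive.
apply: filterS (near_chart Up (dom_open (atlas M c)) Up) => y [q [Uq _ ->]].
by rewrite coordK // (alternating_pullback _ (altT _ _ Uq)).
Qed.

End CovariantDerivative.

(** * The torsion of a Cayley form *)

(** By the cofactor formula, since a determinant of stationary entries is stationary. It is applied
    to the metric in the parallel frame, whose entries are stationary because [nabla g = 0]. *)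
Lemma is_derive_invmx0 (R : realType) (V : normedModType R) n (x v : V)
    (A : V -> 'M[R]_n) :
  (\forall y \near x, A y \in unitmx) ->
  (forall i j, is_derive x v (fun y => A y i j) 0) ->
  forall i j, is_derive x v (fun y => invmx (A y) i j) 0.
Proof.
move=> uA dA i j.
have det0 m (B : V -> 'M[R]_m) :
    (forall i j, is_derive x v (fun y => B y i j) 0) ->
    is_derive x v (fun y => \det (B y)) 0.
  move=> dB; apply: is_derive_eq.
    apply: is_derive_bigsum => s; apply: is_derive_mul (is_derive_cst _ _ _) _.
    by apply: is_derive_prod => k; apply: dB.
  apply: big1 => s _; rewrite mul0r add0r big1 ?mulr0 // => k _.
  by rewrite mul0r.
apply: (near_eq_is_derive (f := fun y => (\det (A y))^-1 * ((-1) ^+ (j + i) *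
    \det (row' j (col' i (A y)))))).
  by apply: filterS uA => y uAy; rewrite /invmx uAy !mxE.
have dC : is_derive x v (fun y => \det (row' j (col' i (A y)))) 0.
  apply: det0 => k l.
  have -> : (fun y => (row' j (col' i (A y))) k l) =
      (fun y => A y (lift j k) (lift i l)) by apply/funext => y; rewrite !mxE.
  exact: dA.
have dD := det0 _ _ dA; have [dDx D0] := dD.
have D_neq0 : \det (A x) != 0 by rewrite -unitfE; apply: (nbhs_singleton uA).
have dV : is_derive x v (fun y => (\det (A y))^-1) 0.
  apply: DeriveDef; first exact: derivableV.
  by rewrite deriveV // D0 scaler0.
have dS := is_derive_cst ((-1) ^+ (j + i) : R) x v.
apply: is_derive_eq (is_derive_mul dV (is_derive_mul dS dC)) _.
by rewrite !(mul0r, mulr0, addr0).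
Qed.

Lemma smooth_on_coord (R : realType) n (U : set 'rV[R]_n) (i : 'I_n) :
  open U -> smooth_on U (fun y : 'rV[R]_n => y 0 i).
Proof.
move=> oU [|k] /=.
  move=> x _; apply: differentiable_continuous; exact: differentiable_coord.
split=> [x _|j]; first exact: differentiable_coord.
apply: (Ck_ext oU) (Ck_cst oU k (i == j)%:R) => x _.
by have [_ <-] := is_derive_coord x j i.
Qed.

Lemma contract2_sym (R : realType) n (h : 'M[R]_n) (F G : 'I_n -> 'I_n -> R) :
  (forall r s, h r s = h s r) -> contract2 h F G = contract2 h G F.
Proof.
move=> sym; rewrite /contract2; under eq_bigr => p _ do rewrite exchange_big.
rewrite exchange_big /=; apply: eq_bigr => r _.
under eq_bigr => p _ do rewrite exchange_big.
rewrite exchange_big /=; apply: eq_bigr => s _; apply: eq_bigr => p _.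
by apply: eq_bigr => q _; rewrite [h p r]sym [h q s]sym; ring.
Qed.

Section Torsion.
Variables (R : realType) (M : manifold R 8).
Variables (Phi : tensor_field M 4) (g : tensor_field M 2) (D : connection M).
Hypotheses (hPhi : cayley_form Phi) (hg : cayley_metric Phi g)
  (hD : levi_civita g D).
Local Notation U c := (dom (atlas M c)).
Local Notation x_ c := (coord (atlas M c)).
Local Notation x_inv c := (param (atlas M c)).
Local Notation gmx c p := (mx_of_tensor (g c p)).

Lemma gmx_unit c p : U c p -> gmx c p \in unitmx.
Proof.
move=> Up; have [A [uA _ gE]] := hg.2 c p Up.
by rewrite (mx_of_metric gE) unitmx_mul unitmx_tr uA.
Qed.

Lemma gmx_sym c p : U c p -> (gmx c p)^T = gmx c p.
Proof.
move=> Up; apply/matrixP => i j; rewrite !mxE.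
by have [sym _] := hg.1 c p Up.
Qed.

(** The determinant of the frame is continuous and equals 1 at the point itself. *)
Lemma near_parallel_frame c p i : U c p ->
  \forall y \near x_ c p, parallel_frame D c p i y \in unitmx.
Proof.
move=> Up; pose f y := \det (parallel_frame D c p i y).
have Sf : smooth_on setT f.
  apply: smooth_on_det => [|r j]; first exact: openT.
  apply: (smooth_on_ext openT (f := fun y => (1%:M : 'M[R]_8) r j +
    - christoffel_mx D c p i r j * (y 0 i + - x_ c p 0 i))).
    by move=> y _; rewrite !mxE mulNr mulrC.
  apply: smooth_onD; [exact: openT|exact: (smooth_on_cst openT)|].
  apply: smooth_onM; [exact: openT|exact: (smooth_on_cst openT)|].
  apply: smooth_onD; [exact: openT| |exact: (smooth_on_cst openT)].
  exact: smooth_on_coord openT.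
have cf : f @ x_ c p --> f (x_ c p) by exact: (Sf 0%N).
have f1 : f (x_ c p) != 0 by rewrite /f parallel_frame_at det1 oner_eq0.
have : \forall y \near x_ c p, f y != 0 by exact: cvgr_neq0 cf f1.
by apply: filterS => y; rewrite unitmxE unitfE.
Qed.

Lemma infinitesimal_nabla c p i : U c p ->
  infinitesimal (invmx (gmx c p)) (Phi c p) (nabla D Phi c p i).
Proof.
move=> Up; set h := invmx _; set X := nabla D Phi c p i.
pose x := x_ c p; pose v : 'rV[R]_8 := delta_mx 0 i.
pose B := parallel_frame D c p i.
pose phi y := pullback (B y) (Phi c (x_inv c y)).
pose gam y := pullback (B y) (g c (x_inv c y)).
pose hh y := invmx (mx_of_tensor (gam y)).
have phix : phi x =1 Phi c p.
  by move=> t; rewrite /phi /x /B parallel_frame_at coordK // pullback1.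
have gamx : gam x =1 g c p.
  by move=> t; rewrite /gam /x /B parallel_frame_at coordK // pullback1.
have gmxx : mx_of_tensor (gam x) = gmx c p.
  by apply/matrixP => r s; rewrite !mxE gamx.
have dphi t : is_derive x v (fun y => phi y t) (X t) by exact: is_derive_nabla.
have dgam t : is_derive x v (fun y => gam y t) 0.
  by have := is_derive_nabla D g i t Up; rewrite hD.2.
(* Changing the frame by the invertible [B y] stays in the orbit of the flat pair, so the quadratic
   identity holds for [phi y] and [gam y] at every nearby [y]. *)
have frame : \forall y \near x, exists A : 'M[R]_8, [/\ A \in unitmx,
    phi y =1 pullback A (cayley0 R) & gam y =1 pullback A (@kronecker R 8)].
  apply: filterS2 (near_chart Up (dom_open (atlas M c)) Up)
    (near_parallel_frame i Up) => y [q [Uq _ yE]] uB.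
  have [A [uA PhiE gE]] := hg.2 c q Uq; exists (A *m B y).
  split=> [|t|t]; first by rewrite unitmx_mul uA.
    by rewrite -pullbackM /phi yE coordK //; apply: eq_pullback.
  by rewrite -pullbackM /gam yE coordK //; apply: eq_pullback.
have dhh r s : is_derive x v (fun y => hh y r s) 0.
  apply: is_derive_invmx0 => [|k l].
    apply: filterS frame => y [A [uA _ gE]].
    by rewrite (mx_of_metric gE) unitmx_mul unitmx_tr uA.
  have -> : (fun y => mx_of_tensor (gam y) k l) = (fun y => gam y [tuple k; l]).
    by apply/funext => y; rewrite mxE.
  exact: dgam.
have hhx : hh x = h by rewrite /hh gmxx.
have sym_h r s : h r s = h s r.
  by rewrite -[h in RHS]trmxK mxE /h trmx_inv gmx_sym.
move=> t; rewrite [t]tuple4_eta permute_pair_swap.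
move: (tnth t 0) (tnth t 1) (tnth t 2) (tnth t 3) => a b k l {t}.
(* This is the double contraction of [phi y] with itself, unfolded so that the rules for sums and
   products apply. The factors [hh] are stationary, so only the two factors [phi] contribute to the
   derivative. *)
pose F y := \sum_r \sum_s \sum_q \sum_q' phi y [tuple a; b; q; q'] * hh y q r *
  hh y q' s * phi y [tuple k; l; r; s].
have dF : is_derive x v F (double_contraction h X (Phi c p) [tuple a; b; k; l]
    + double_contraction h (Phi c p) X [tuple a; b; k; l]).
  have dterm r s q q' := is_derive_mul (is_derive_mul (is_derive_mul
    (dphi [tuple a; b; q; q']) (dhh q r)) (dhh q' s)) (dphi [tuple k; l; r; s]).
  have dq r s q := is_derive_bigsum (dterm r s q).
  have ds r s := is_derive_bigsum (dq r s).
  have dr r := is_derive_bigsum (ds r).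
  apply: is_derive_eq (is_derive_bigsum dr) _.
  rewrite /double_contraction /contract2 -big_split; apply: eq_bigr => r _ /=.
  rewrite -big_split; apply: eq_bigr => s _ /=.
  rewrite -big_split; apply: eq_bigr => q _ /=.
  rewrite -big_split; apply: eq_bigr => q' _ /=.
  by rewrite hhx !phix !mulr0 !addr0.
(* The metric products are stationary, which leaves -4 times the derivative of [phi]. *)
have dG : is_derive x v (fun y =>
    6 * (gam y [tuple a; k] * gam y [tuple b; l]
         + - (gam y [tuple a; l] * gam y [tuple b; k]))
    + - 4 * phi y [tuple a; b; k; l]) (- 4 * X [tuple a; b; k; l]).
  have dgg i1 i2 i3 i4 :=
    is_derive_mul (dgam [tuple i1; i2]) (dgam [tuple i3; i4]).
  have d6 := is_derive_cst (6 : R) x v; have d4 := is_derive_cst (- 4 : R) x v.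
  apply: is_derive_eq (is_deriveD (is_derive_mul d6 (is_deriveD (dgg a k b l)
    (is_deriveN (dgg a l b k))))
    (is_derive_mul d4 (dphi [tuple a; b; k; l]))) _.
  by rewrite !(mul0r, mulr0, addr0, add0r, oppr0).
have FG : \forall y \near x, F y =
    6 * (gam y [tuple a; k] * gam y [tuple b; l]
         + - (gam y [tuple a; l] * gam y [tuple b; k]))
    + - 4 * phi y [tuple a; b; k; l].
  apply: filterS frame => y [A [uA phiE gamE]].
  have -> : F y = double_contraction (hh y) (phi y) (phi y) [tuple a; b; k; l].
    by [].
  by rewrite /hh (quadratic_identity uA phiE gamE) mulNr.
have [_ <-] := dG; rewrite -(near_eq_derive v FG); have [_ ->] := dF.
(* The term with the differentiated factor first becomes the pair-swapped contraction, by the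
   symmetry of the inverse metric. *)
by rewrite addrC; congr (_ + _); apply: contract2_sym.
Qed.

(** * Smoothness and tensoriality of the torsion 3-form *)

Local Notation Tor c p :=
  (torsion3 (invmx (gmx c p)) (Phi c p) (nabla D Phi c p)).

Let codom c := x_ c @` U c.
Let open_codom c : open (codom c) := @codom_open _ _ _ (atlas M c).

Lemma smooth_in_partial c i (f : M -> R) :
  smooth_in c f -> smooth_in c (partial_at c i f).
Proof.
move=> Sf; apply: (smooth_on_ext (open_codom (c := c)))
  (smooth_on_partial i Sf) => _ [q Uq <-].
by rewrite /partial_at coordK.
Qed.

Lemma smooth_in_nabla c i t : smooth_in c (fun p => nabla D Phi c p i t).
Proof.
have oc := open_codom (c := c); apply: (smooth_onD oc).
  apply: smooth_in_partial; exact: component_smooth.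
apply: (smooth_on_ext oc (f := fun y => -1 * (\sum_s \sum_q
    D c (x_inv c y) q i (tnth t s) * Phi c (x_inv c y) (replace t s q)))).
  by move=> y _; rewrite mulN1r.
apply: (smooth_onM oc); first exact: smooth_on_cst.
apply: (smooth_on_sum oc) => s _; apply: (smooth_on_sum oc) => q _.
apply: (smooth_onM oc); first exact: christoffel_smooth.
exact: component_smooth.
Qed.

Lemma smooth_in_invmx c r s : smooth_in c (fun p => invmx (gmx c p) r s).
Proof.
have oc := open_codom (c := c).
apply: (smooth_on_invmx oc) => [_ [q Uq <-]|k l].
  by rewrite coordK // gmx_unit.
apply: (smooth_on_ext oc) (component_smooth g c [tuple k; l]) => y _.
by rewrite mxE.
Qed.

Lemma smooth_in_torsion3 c t : smooth_in c (fun p => Tor c p t).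
Proof.
have oc := open_codom (c := c).
have Sdiv u : smooth_in c (fun p =>
    divergence (invmx (gmx c p)) (nabla D Phi c p) u).
  apply: (smooth_on_sum oc) => q _; apply: (smooth_on_sum oc) => r _.
  apply: (smooth_onM oc); first exact: smooth_in_invmx.
  exact: smooth_in_nabla.
apply: (smooth_onM oc); first exact: smooth_on_cst.
apply: (smooth_on_sum oc) => s _; apply: (smooth_onM oc).
  exact: smooth_on_cst.
move: (permute s t) => u; apply: (smooth_onD oc).
  apply: (smooth_onM oc); first exact: smooth_on_cst.
  exact: Sdiv.
pose F y := contract2 (invmx (gmx c (x_inv c y)))
  (fun r s => divergence (invmx (gmx c (x_inv c y))) (nabla D Phi c (x_inv c y))
     [tuple tnth u 0; r; s])
  (fun p q => Phi c (x_inv c y) [tuple tnth u 1; tnth u 2; p; q]).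
apply: (smooth_on_ext oc (f := fun y => - 8^-1 * F y)) => [y _|].
  by rewrite mulNr.
apply: (smooth_onM oc); first exact: smooth_on_cst.
apply: (smooth_on_sum oc) => p _; apply: (smooth_on_sum oc) => q _.
apply: (smooth_on_sum oc) => r _; apply: (smooth_on_sum oc) => s' _.
apply: (smooth_onM oc); last exact: component_smooth.
apply: (smooth_onM oc); last exact: smooth_in_invmx.
apply: (smooth_onM oc); last exact: smooth_in_invmx.
exact: Sdiv.
Qed.

Lemma invmx_change c d p : U c p -> U d p ->
  jacobian c d p *m invmx (gmx d p) *m (jacobian c d p)^T = invmx (gmx c p).
Proof.
move=> Uc Ud; set J := jacobian c d p.
have gE : gmx d p = J^T *m gmx c p *m J.
  rewrite -mx_of_pullback; apply/matrixP => r s.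
  by rewrite [LHS]mxE [RHS]mxE (component_change g Uc Ud).
have inv1 : gmx c p *m (J *m invmx (gmx d p) *m J^T) = 1%:M.
  rewrite !mulmxA; apply: mulmx1C; rewrite !mulmxA -gE mulmxV //.
  exact: gmx_unit.
by rewrite -(mulKmx (gmx_unit Uc) (J *m _ *m _)) inv1 mulmx1.
Qed.

Lemma torsion3_change c d p : U c p -> U d p ->
  Tor d p =1 pullback (jacobian c d p) (Tor c p).
Proof.
move=> Uc Ud; apply: torsion3_pullback.
- exact: invmx_change.
- exact: component_change.
- by move=> m t; apply: nabla_change.
Qed.

Definition torsion_field : tensor_field M 3 :=
  TensorField smooth_in_torsion3 torsion3_change.

Lemma nabla_torsion_action c p i t : U c p ->
  nabla D Phi c p i t =
  4 * torsion_action (g c p) (Phi c p) (torsion_field c p) i t.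
Proof.
move=> Up; have [A [uA PhiE gE]] := hg.2 c p Up.
apply: (torsion3_action uA PhiE gE) => j.
  exact: alternating_nabla hPhi.1 Up.
exact: infinitesimal_nabla.
Qed.

End Torsion.

Theorem proposition1p1 (R : realType) (M : manifold R 8)
    (Phi : tensor_field M 4) (g : tensor_field M 2) (D : connection M)
    (hPhi : cayley_form Phi) (hg : cayley_metric Phi g)
    (hD : levi_civita g D) :
  (forall (c : chart_index M) (p : M) (i : 'I_8), dom (atlas M c) p ->
     Lambda4_7 (g c p) (Phi c p) (nabla D Phi c p i)) /\
  (exists T : tensor_field M 3, is_form T /\
     forall (c : chart_index M) (p : M) (i a b d e : 'I_8),
       dom (atlas M c) p ->
       nabla D Phi c p i [tuple a; b; d; e] =
       4 * torsion_action (g c p) (Phi c p) (T c p) i [tuple a; b; d; e]).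
Proof.
split=> [c p i Up|].
  have altX := alternating_nabla D i hPhi.1 Up.
  by split=> //; apply: infinitesimal_J4 altX (infinitesimal_nabla hg hD i Up).
exists (torsion_field D hg); split=> [c p Up|c p i a b d e Up].
  exact: alternating_alt.
exact: nabla_torsion_action.
Qed.
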